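(* Let $P$ and $Q$ be polytopes and let $P\oplus_p Q$ be their vertex sum at a vertex $p$. If $T_P\subseteq I_P$ and $T_Q\subseteq I_Q$, then $T_{P\oplus_p Q}\subseteq I_{P\oplus_p Q}$. In particular, if $P$ and $Q$ are graphic then $P\oplus_p Q$ is graphic.
   Context: Vertex sum: for $P$ of dimension $d$ with vertex $v$ and $Q$ of dimension $e$ with vertex $w$, embed $P,Q$ in $\mathbb{R}^{d+e}$ so that their affine spans meet in a single point $p$ which is the image of both $v$ and $w$; $P\oplus_p Q$ is the convex hull of the union (considered up to combinatorial equivalence). For a $D$-polytope $R$ with facets $F_i$ (given by affine $h_i\ge0$ vanishing on $F_i$) and vertices $v_j$, the symbolic slack matrix $S_R(\mathbf z)$ replaces each nonzero entry of $[h_i(v_j)]$ (pairs with $v_j\notin F_i$) by a distinct variable; $I_R$ is the ideal of $(D+2)$-minors of $S_R$ saturated by the product of all variables. The non-incidence graph $\mathbf G_R$ is bipartite on facets $\sqcup$ vertices, edge $\{F,v\}$ iff $v\notin F$, labeled by the variable at $(F,v)$. For a directed cycle $C$, $f_C$ = (product of labels of edges directed facet$\to$vertex) $-$ (product of labels of edges directed vertex$\to$facet). $T_R$ is generated by $f_C$ over chordless cycles of $\mathbf G_R$. $R$ is graphic if $I_R=T_R$. *)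

(* Defs.v *)
From HB Require Import structures.
From mathcomp Require Import all_boot all_order all_algebra.
From mathcomp Require Import boolp classical_sets.
From mathcomp Require Export mpoly.

Set Implicit Arguments.
Unset Strict Implicit.
Unset Printing Implicit Defensive.

Import Order.TTheory GRing.Theory Num.Theory.
Local Open Scope ring_scope.
Local Open Scope classical_set_scope.

Section ConvexGeometry.
Variables (R : realFieldType) (m : nat).
Implicit Types A : set 'rV[R]_m.

Definition conv_hull A : set 'rV[R]_m :=
  [set y | exists (n : nat) (x : 'I_n -> 'rV[R]_m) (c : 'I_n -> R),
    [/\ forall i, A (x i), forall i, 0 <= c i, \sum_i c i = 1
      & y = \sum_i c i *: x i]].

Definition aff_span A : set 'rV[R]_m :=
  [set y | exists (n : nat) (x : 'I_n -> 'rV[R]_m) (c : 'I_n -> R),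
    [/\ forall i, A (x i), \sum_i c i = 1 & y = \sum_i c i *: x i]].

Definition aff_form (a : 'cV[R]_m) (c : R) (x : 'rV[R]_m) : R :=
  (x *m a) 0 0 + c.

(* A face is represented by the set of (indices of) the vertices it contains.
   With a = 0, both the empty face and the whole polytope are faces. *)
Definition face_of n (vert : 'I_n -> 'rV[R]_m) (S : {set 'I_n}) : Prop :=
  exists (a : 'cV[R]_m) (c : R),
    (forall x, conv_hull (range vert) x -> 0 <= aff_form a c x) /\
    (forall i, (i \in S) = (aff_form a c (vert i) == 0)).

End ConvexGeometry.

Definition aff_map (R : realFieldType) (m n : nat) (A : 'M[R]_(m, n))
  (b : 'rV[R]_n) (x : 'rV[R]_m) : 'rV[R]_n := x *m A + b.

(* A nonempty polytope, given by the list of its vertices: [vert_face] says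
   that every listed point is a vertex, i.e. a face on its own; in particular
   [vert] is injective. *)
Record polytope (R : realFieldType) (m : nat) := Polytope {
  nvert : nat;
  vert : 'I_nvert -> 'rV[R]_m;
  nvert_gt0 : (0 < nvert)%N;
  vert_face : forall i, face_of vert [set i]%SET }.

Notation vertex P := 'I_(nvert P).

Section Polytope.
Variables (R : realFieldType) (m : nat) (P : polytope R m).

Definition points : set 'rV[R]_m := conv_hull (range (@vert R m P)).

Definition is_face (S : {set vertex P}) : Prop := face_of (@vert R m P) S.

(* 1 + the dimension of the affine span of S: the rank of the homogenized
   points (1, x); it is 0 for the empty set. *)
Definition arank (S : {set vertex P}) : nat :=
  \rank (\sum_(i in S) <<row_mx (1 : 'rV[R]_1) (vert i)>>)%MS.

Definition pdim : nat := (arank [set: vertex P]%SET).-1.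

(* faces of dimension pdim P - 1 *)
Definition is_facet (S : {set vertex P}) : Prop :=
  is_face S /\ (arank S).+1 = arank [set: vertex P]%SET.

Definition facet := {S : {set vertex P} | `[< is_facet S >]}.

Definition incident (F : facet) (v : vertex P) : bool := v \in val F.

End Polytope.

(* Isomorphism of face lattices, g being the inverse of f on faces. *)
Definition comb_equiv (R : realFieldType) (m n : nat)
    (P : polytope R m) (Q : polytope R n) : Prop :=
  exists (f : {set vertex P} -> {set vertex Q})
         (g : {set vertex Q} -> {set vertex P}),
    [/\ forall S, is_face S -> is_face (f S) /\ g (f S) = S,
        forall T, is_face T -> is_face (g T) /\ f (g T) = T
      & forall S S', is_face S -> is_face S' ->
          (f S \subset f S') = (S \subset S')].

Definition is_vertex_sum (R : realFieldType) (a b c : nat)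
    (P : polytope R a) (v : vertex P) (Q : polytope R b) (w : vertex Q)
    (W : polytope R c) : Prop :=
  exists (A : 'M[R]_(a, pdim P + pdim Q)) (s : 'rV[R]_(pdim P + pdim Q))
         (B : 'M[R]_(b, pdim P + pdim Q)) (t : 'rV[R]_(pdim P + pdim Q))
         (p : 'rV[R]_(pdim P + pdim Q)) (W0 : polytope R (pdim P + pdim Q)),
    let P' := aff_map A s @` points P in
    let Q' := aff_map B t @` points Q in
    [/\ {in aff_span (points P) &, injective (aff_map A s)},
        {in aff_span (points Q) &, injective (aff_map B t)},
        aff_map A s (vert v) = p /\ aff_map B t (vert w) = p,
        aff_span P' `&` aff_span Q' = [set p]
      & points W0 = conv_hull (P' `|` Q') /\ comb_equiv W0 W].

Section Ideals.
Variable A : comNzRingType.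

Definition ideal_gen (G : set A) : set A :=
  [set f | exists s : seq (A * A),
    (forall t, t \in s -> G t.2) /\ f = \sum_(t <- s) t.1 * t.2].

Definition saturation (I : set A) (x : A) : set A :=
  [set f | exists n, I (x ^+ n * f)].

End Ideals.

Section Slack.
Variables (k : fieldType) (R : realFieldType) (m : nat) (P : polytope R m).

Definition nonincident_pair := {e : facet P * vertex P | ~~ incident e.1 e.2}.

(* k[z], with one variable for each non-incident pair. *)
Definition slack_ring := {mpoly k[#|{: nonincident_pair}|]}.

Definition slack_mx (F : facet P) (v : vertex P) : slack_ring :=
  if insub (F, v) is Some e then 'X_(enum_rank (e : nonincident_pair)) else 0.

Definition slack_minor : set slack_ring :=
  [set f | exists (r : 'I_(pdim P).+2 -> facet P)
                    (c : 'I_(pdim P).+2 -> vertex P),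
    [/\ injective r, injective c
      & f = \det (\matrix_(i, j) slack_mx (r i) (c j))]].

Definition slack_ideal : set slack_ring :=
  saturation (ideal_gen slack_minor) (\prod_i 'X_i).

Definition nonincidence_graph : rel (facet P + vertex P) :=
  fun x y => match x, y with
    | inl F, inr v | inr v, inl F => ~~ incident F v
    | _, _ => false
  end.

(* A directed cycle is a duplicate-free cyclic list of nodes; [2 < size C]
   excludes going back and forth along a single edge. *)
Definition chordless_cycle (C : seq (facet P + vertex P)) : Prop :=
  [/\ (2 < size C)%N, ucycle nonincidence_graph C
    & {in C &, forall x y, nonincidence_graph x y ->
        y = next C x \/ x = next C y}].

(* Label of the edge from x to y if it is directed facet -> vertex, else 1. *)
Definition label (x y : facet P + vertex P) : slack_ring :=
  match x, y with inl F, inr v => slack_mx F v | _, _ => 1 end.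

Definition cycle_binomial (C : seq (facet P + vertex P)) : slack_ring :=
  \prod_(x <- C) label x (next C x) - \prod_(x <- C) label (next C x) x.

Definition graph_ideal : set slack_ring :=
  ideal_gen [set f | exists2 C, chordless_cycle C & f = cycle_binomial C].

Definition graphic : Prop := slack_ideal = graph_ideal.

End Slack.

Arguments slack_minor k {R m} P.
Arguments slack_ideal k {R m} P.
Arguments graph_ideal k {R m} P.

(* Main.v *)
(** For a vertex sum W of P and Q at p, with p identified with the vertex v of P
    and the vertex w of Q, the faces of W are the pairs of a face S of P and a
    face T of Q with v in S iff w in T; a pair of functionals cutting out S and T
    extends, after scaling, to the sum. So the facets of W are F and all of Q for
    a facet F through v, symmetrically for Q, and the pairs (F, G) of facets
    avoiding v and w; and dim W = dim P + dim Q.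

    A (dim P + 2)-minor of S_W whose columns are vertices of P, bordered by a
    triangular block coming from a flag of Q starting at w, becomes a
    (dim W + 2)-minor, up to a monomial factor that saturation removes. Hence
    each choice of facets of W over those of P maps I_P into I_W. Bordering
    further by a flag of P ending at F shows that the 2x2 minors on two facets
    of W with the same trace F on P are in I_W.

    T_P contains all binomials x^m - x^m' where m and m' have equal degree at each
    node of the bipartite graph: subtract alternating cycles, and split cycles
    along chords (Ohsugi-Hibi). Since I_W is saturated, the vectors m - m' with
    x^m - x^m' in I_W form a group, and an integer vector with zero sums at the
    nodes of the graph of W decomposes into one from P, one from Q, and 2x2
    minors as above. So T_W is contained in I_W.

    Conversely T_W is the kernel of z_{F,u} |-> a_F b_u, a domain-valued map
    killing no variable, so I_W is contained in T_W as soon as the 0/1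
    non-incidence matrix of W has rank at most dim W + 1. For graphic P and Q
    the analogous rank bounds hold, and the column spaces for P and Q share the
    nonzero column of p, so that rank W <= (dim P + 1) + (dim Q + 1) - 1. *)

From HB Require Import structures.
Require Import Defs.
From mathcomp Require Import all_boot all_order all_algebra.
From mathcomp Require Import boolp classical_sets.
(* Imported again: the names set0, subsetP, ... must denote those of finset. *)
From mathcomp Require Import fintype finset.
From mathcomp Require Import ring.

Set Implicit Arguments.
Unset Strict Implicit.
Unset Printing Implicit Defensive.

Import Order.TTheory GRing.Theory Num.Theory.
Local Open Scope ring_scope.

(** * Faces of a polytope *)

Section AffineForms.
Variables (R : realFieldType) (m : nat).
Implicit Types (h : 'cV[R]_(1 + m)) (x : 'rV[R]_m).

(** Homogenization: a column [h] stands for an affine form, constant term first, so that ranks of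
    point sets and values of forms are handled by the same matrices. *)
Definition hom x : 'rV[R]_(1 + m) := row_mx 1 x.
Definition hev h x : R := (hom x *m h) 0 0.

Lemma aff_formE a c x : aff_form a c x = hev (col_mx c%:M a) x.
Proof.
by rewrite /aff_form /hev /hom mul_row_col mul1mx !mxE eqxx mulr1n addrC.
Qed.

Lemma hevD h1 h2 x : hev (h1 + h2) x = hev h1 x + hev h2 x.
Proof. by rewrite /hev mulmxDr mxE. Qed.

Lemma hevZ c h x : hev (c *: h) x = c * hev h x.
Proof. by rewrite /hev -scalemxAr mxE. Qed.

Lemma hev_const c x : hev (col_mx c%:M 0) x = c.
Proof. by rewrite -aff_formE /aff_form mulmx0 mxE add0r. Qed.

Lemma hom_sum n (y : 'I_n -> 'rV[R]_m) (c : 'I_n -> R) :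
  \sum_i c i *: hom (y i) = row_mx (\sum_i c i)%:M (\sum_i c i *: y i).
Proof.
elim/big_rec3: _ => [|i u z t _ ->]; first by rewrite -row_mx0 -scalemx1 scale0r.
by rewrite /hom scale_row_mx add_row_mx scalemx1 -raddfD.
Qed.

Lemma hev_comb n (y : 'I_n -> 'rV[R]_m) (c : 'I_n -> R) h :
  \sum_i c i = 1 -> hev h (\sum_i c i *: y i) = \sum_i c i * hev h (y i).
Proof.
move=> c1; have -> : \sum_i c i * hev h (y i) =
    ((\sum_i c i *: hom (y i)) *m h) 0 0.
  by rewrite mulmx_suml summxE; apply: eq_bigr => i _; rewrite -scalemxAl mxE.
by rewrite hom_sum c1.
Qed.

(** All terms of the combination are nonnegative, so a zero value would make every coefficient
    vanish, against their sum 1. *)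
Lemma conv_hull_gt0 h (A : set 'rV[R]_m) :
  (forall x, A x -> 0 < hev h x) -> forall x, conv_hull A x -> 0 < hev h x.
Proof.
move=> hA _ [n [y [c [yA c0 c1 ->]]]]; rewrite hev_comb // lt0r.
have t0 i : 0 <= c i * hev h (y i) by rewrite mulr_ge0 // ltW // hA.
rewrite sumr_ge0 // andbT; apply/negP; rewrite psumr_eq0 // => /allP z.
have: \sum_i c i = 0.
  apply: big1 => i _; have := z i; rewrite mem_index_enum => /(_ isT).
  by rewrite mulf_eq0 (gt_eqF (hA _ (yA i))) orbF => /eqP.
by rewrite c1 => /eqP; rewrite oner_eq0.
Qed.

Lemma conv_hull_ge0 h (A : set 'rV[R]_m) :
  (forall x, A x -> 0 <= hev h x) -> forall x, conv_hull A x -> 0 <= hev h x.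
Proof.
move=> hA _ [n [y [c [yA c0 c1 ->]]]]; rewrite hev_comb //.
by apply: sumr_ge0 => i _; rewrite mulr_ge0 // hA.
Qed.

(** The zero set on [A] is only required to lie in the singleton of [z]: [z] need not belong to
    [A]. *)
Definition exposes h (z : 'rV[R]_m) (A : set 'rV[R]_m) :=
  forall x, A x -> 0 <= hev h x /\ (hev h x = 0 -> x = z).

Lemma conv_hull_exposes h z A : exposes h z A -> exposes h z (conv_hull A).
Proof.
move=> hA x Ax; split; first by apply: conv_hull_ge0 Ax => y /hA[].
case: Ax => n [y [c [yA c0 c1 ->]]]; rewrite hev_comb // => /eqP.
rewrite psumr_eq0 => [/allP t0|i _]; last by rewrite mulr_ge0 //; case: (hA _ (yA i)).
rewrite -[RHS]scale1r -c1 scaler_suml; apply: eq_bigr => i _.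
have := t0 i; rewrite mem_index_enum => /(_ isT); rewrite mulf_eq0.
case/orP=> [/eqP->|/eqP e]; first by rewrite !scale0r.
by have [_ ->] := hA _ (yA i).
Qed.

Lemma sub_conv_hull (A : set ('rV[R]_m)) : (A `<=` conv_hull A)%classic.
Proof.
move=> x Ax; exists 1%N, (fun=> x), (fun=> 1).
by rewrite !big_ord1 scale1r.
Qed.

End AffineForms.

Section Faces.
Variables (R : realFieldType) (m : nat) (P : polytope R m).
Implicit Types (S : {set vertex P}) (i : vertex P) (h : 'cV[R]_(1 + m)).

Local Notation ev h i := (hev h (vert i)).

Lemma is_faceP S : is_face S <->
  exists h, (forall i, 0 <= ev h i) /\ (forall i, (i \in S) = (ev h i == 0)).
Proof.
split=> [[a [c [ge0 eS]]]|[h [ge0 eS]]].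
  exists (col_mx c%:M a); split=> i; rewrite -aff_formE //.
  by apply: ge0; apply: sub_conv_hull; exists i.
have E : h = col_mx (usubmx h 0 0)%:M (dsubmx h).
  by rewrite -mx11_scalar vsubmxK.
exists (dsubmx h), (usubmx h 0 0); split=> [x|i]; rewrite aff_formE -E //.
by apply: conv_hull_ge0 => _ [i _ <-].
Qed.

Lemma is_face0 : is_face (set0 : {set vertex P}).
Proof.
apply/is_faceP; exists (col_mx 1%:M 0); split=> i; rewrite hev_const ?ler01 //.
by rewrite inE oner_eq0.
Qed.

Lemma is_faceT : is_face [set: vertex P]%SET.
Proof.
by apply/is_faceP; exists 0; split=> i; rewrite /hev mulmx0 mxE ?inE ?eqxx.
Qed.

Lemma is_face1 i : is_face [set i]%SET. Proof. exact: vert_face. Qed.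

Local Notation hspan S := (\sum_(i in S) <<hom (vert i)>>)%MS.

Lemma arankE S : arank S = \rank (hspan S). Proof. by []. Qed.

Lemma hom_sub_span S i : i \in S -> (hom (vert i) <= hspan S)%MS.
Proof.
by move=> iS; apply: submx_trans (sumsmx_sup i _ _); rewrite ?genmxE // submx_refl.
Qed.

Lemma hev_span0 S h : (forall i, i \in S -> ev h i = 0) -> hspan S *m h = 0.
Proof.
move=> h0; have : (hspan S <= kermx h)%MS.
  apply/sumsmx_subP => i iS; rewrite genmxE; apply/sub_kermxP/matrixP=> a b.
  by rewrite !ord1 [RHS]mxE -[LHS]/(ev h i) h0.
by move/sub_kermxP.
Qed.

Lemma sub_span_hev0 S h i :
    (forall i, i \in S -> ev h i = 0) -> (hom (vert i) <= hspan S)%MS ->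
  ev h i = 0.
Proof.
by move=> h0 /submxP[D E]; rewrite /hev E -mulmxA hev_span0 // mulmx0 mxE.
Qed.

Lemma separate_span (B : 'M[R]_(1 + m)) i : ~~ (hom (vert i) <= B)%MS ->
  exists2 h, B *m h = 0 & ev h i != 0.
Proof.
rewrite submxE => /rV0Pn[j nz]; exists (col j (cokermx B)).
  by rewrite colE mulmxA mulmx_coker mul0mx.
by rewrite /hev colE mulmxA -colE mxE.
Qed.

Lemma sub_mul0 n p q (A : 'M[R]_(n, q)) (B : 'M_(p, q)) (h : 'cV[R]_q) :
  (A <= B)%MS -> B *m h = 0 -> A *m h = 0.
Proof. by move=> /submxP[D ->] B0; rewrite -mulmxA B0 mulmx0. Qed.

Lemma hspanS S S' : S \subset S' -> (hspan S <= hspan S')%MS.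
Proof.
move=> /subsetP sS; apply/sumsmx_subP => i iS; rewrite genmxE.
by apply: hom_sub_span; apply: sS.
Qed.

Lemma arankS S S' : S \subset S' -> (arank S <= arank S')%N.
Proof. by move=> /hspanS; apply: mxrankS. Qed.

Lemma face_notin_span S i :
  is_face S -> i \notin S -> ~~ (hom (vert i) <= hspan S)%MS.
Proof.
move=> /is_faceP[h [_ hS]]; apply: contra => iS; rewrite hS.
by apply/eqP; apply: (sub_span_hev0 _ iS) => j; rewrite hS => /eqP.
Qed.

Lemma arank_lt S S' : is_face S -> S \proper S' -> (arank S < arank S')%N.
Proof.
move=> fS /properP[sS [i iS' iS]]; rewrite !arankE ltn_neqAle mxrankS ?hspanS //.
rewrite andbT; apply: contra (face_notin_span fS iS) => /eqP e.
apply: submx_trans (hom_sub_span iS') _.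
by rewrite -(geq_leqif (mxrank_leqif_sup (hspanS sS))) e.
Qed.

Lemma arank0 : arank (set0 : {set vertex P}) = 0%N.
Proof. by rewrite arankE big_set0 mxrank0. Qed.

Lemma hom_neq0 (x : 'rV[R]_m) : hom x != 0.
Proof.
apply/eqP => e; have := congr1 (fun M : 'rV_(1 + m) => M 0 (lshift m 0)) e.
by rewrite /hom row_mxEl !mxE => /eqP; rewrite oner_eq0.
Qed.

Lemma arank1 i : arank [set i]%SET = 1%N.
Proof. by rewrite arankE big_set1 mxrank_gen rank_rV hom_neq0. Qed.

Lemma arankT : arank [set: vertex P]%SET = (pdim P).+1.
Proof.
rewrite /pdim prednK //.
by rewrite -(arank1 (Ordinal (nvert_gt0 P))); apply/arankS/subsetT.
Qed.

(* Tilt a functional cutting out S, keeping it constant on S and y, until it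
   first vanishes at a further vertex of S'. *)
Lemma face_between S S' y :
    is_face S -> is_face S' -> S \subset S' -> y \in S' -> y \notin S ->
    (arank S + 1 < arank S')%N ->
  exists T, [/\ is_face T, S \proper T, T \subset S' & y \notin T].
Proof.
move=> /is_faceP[h [h0 hS]] /is_faceP[h' [h'0 hS']] sSS' yS' yS lt_rk.
(* The tilting form must vanish on [S] and [y]; the rank gap leaves a vertex [z] of [S'] off their
   span, where it can be nonzero. *)
pose B := (hspan S + <<hom (vert y)>>)%MS.
have [z zS' zB] : exists2 z, z \in S' & ~~ (hom (vert z) <= B)%MS.
  apply/exists_inP; apply: contraLR lt_rk => /exists_inPn sB.
  rewrite -leqNgt arankE; apply: leq_trans (_ : \rank B <= _)%N.
    apply: mxrankS; apply/sumsmx_subP => z zS'; rewrite genmxE.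
    by have := sB z zS'; rewrite negbK.
  apply: leq_trans (mxrank_adds_leqif _ _) _; rewrite leq_add2l mxrank_gen.
  exact: rank_leq_row.
have [g gB gz] := separate_span zB.
wlog {gz} gz : g gB / ev g z < 0.
  move=> wl; case/lt_total/orP: gz => gz; first exact: (wl g).
  apply: (wl (- g)); first by rewrite mulmxN gB oppr0.
  by rewrite -scaleN1r hevZ mulN1r oppr_lt0.
have gBz i : (hom (vert i) <= B)%MS -> ev g i = 0.
  by move=> iB; rewrite /hev (sub_mul0 iB gB) mxE.
have gy : ev g y = 0.
  by apply: gBz; apply: submx_trans (addsmxSr _ _); rewrite genmxE.
have gS i : i \in S -> ev g i = 0.
  by move=> iS; apply: gBz; apply: submx_trans (addsmxSl _ _); apply: hom_sub_span.
(* [ratio i] is the t at which [h + t *: g] vanishes at [i]; the least one over the vertices of [S']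
   where [g] is negative keeps the form nonnegative on [S']. *)
pose ratio i := ev h i / (- ev g i).
pose cand i := (i \in S') && (ev g i < 0).
have candz : cand z by rewrite /cand zS'.
pose t := ratio [arg min_(i < z | cand i) ratio i]%O.
have [z1 [/andP[z1S' gz1] tz1 tmin]] :
    exists z1, [/\ cand z1, t = ratio z1 & forall j, cand j -> t <= ratio j].
  by rewrite /t; case: arg_minP => // j cj jm; exists j.
have t0 : 0 <= t by rewrite tz1 /ratio divr_ge0 // oppr_ge0 ltW.
have kS' i : i \in S' -> 0 <= ev h i + t * ev g i.
  move=> iS'; have [gi|gi] := ltP (ev g i) 0; last by rewrite addr_ge0 // mulr_ge0.
  have := tmin i; rewrite /cand iS' gi => /(_ isT).
  by rewrite /ratio ler_pdivlMr ?oppr_gt0 // mulrN -subr_ge0 opprK.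
have h'S' i : i \notin S' -> 0 < ev h' i by rewrite hS' lt0r h'0 andbT.
(* [h'] vanishes on [S'] and is positive off it; each summand of [N] alone makes the tilted form
   positive at its own vertex. *)
pose N := \sum_(i | i \notin S') ((`|ev h i + t * ev g i| + 1) / ev h' i).
have NP i : i \notin S' -> 0 < ev h i + t * ev g i + N * ev h' i.
  move=> iS'; have hi := h'S' i iS'.
  have : `|ev h i + t * ev g i| + 1 <= N * ev h' i.
    rewrite -ler_pdivrMr // /N (bigD1 i) //= lerDl; apply: sumr_ge0 => j.
    by move=> /andP[jS' _]; rewrite divr_ge0 // addr_ge0.
  move=> le; set q := ev h i + t * ev g i in le *.
  apply: lt_le_trans (_ : 0 < q + (`|q| + 1)) _.
    by rewrite addrA ltr_wpDl // -lerBlDl sub0r -normrN ler_norm.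
  by rewrite lerD2l.
have kE i : ev (h + t *: g + N *: h') i = ev h i + t * ev g i + N * ev h' i.
  by rewrite !hevD !hevZ.
have kES' i : i \in S' -> ev (h + t *: g + N *: h') i = ev h i + t * ev g i.
  by move=> iS'; rewrite kE (eqP (_ : ev h' i == 0)) ?mulr0 ?addr0 // -hS'.
pose k := h + t *: g + N *: h'.
have k0 i : 0 <= ev k i.
  have [iS'|iS'] := boolP (i \in S'); first by rewrite kES' // kS'.
  by rewrite kE ltW // NP.
exists [set i | ev k i == 0]%SET; split.
- by apply/is_faceP; exists k; split=> // i; rewrite inE.
- apply/properP; split.
    apply/subsetP => i iS; rewrite inE kES' ?(subsetP sSS') // gS // mulr0 addr0.
    by rewrite -hS.
  exists z1; last by apply/negP => /gS e; rewrite e ltxx in gz1.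
  rewrite inE kES' // tz1 /ratio invrN mulrN mulNr divfK ?subrr //.
  by rewrite lt_eqF.
- apply/subsetP => i; rewrite inE; apply: contraLR => iS'.
  by rewrite kE gt_eqF // NP.
- by rewrite inE kES' // gy mulr0 addr0 -hS.
Qed.

(** [face_between] enlarges [S] without capturing [y] as long as the rank gap exceeds 1; induction
    on the number of missing vertices. *)
Lemma face_sep S S' y :
    is_face S -> is_face S' -> S \subset S' -> y \in S' -> y \notin S ->
  exists T, [/\ is_face T, S \subset T, T \subset S', y \notin T
    & (arank T).+1 = arank S'].
Proof.
move=> fS fS'; have [n] := ubnP (#|S'| - #|S|)%N.
elim: n S fS => // n IHn S fS le_n sS yS' yS.
have ltS : (arank S < arank S')%N.
  by apply: arank_lt => //; apply/properP; split=> //; exists y.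
have [ge|lt] := leqP (arank S') (arank S + 1).
  by exists S; split=> //; apply/eqP; rewrite eqn_leq ltS -addn1 ge.
have [T [fT prT sT yT]] := face_between fS fS' sS yS' yS lt.
have [|U [fU sTU sU yU rU]] := IHn T fT _ sT yS' yT.
  rewrite ltnS in le_n; apply: leq_trans le_n.
  apply: ltn_sub2l; apply: proper_card => //.
  by apply/properP; split=> //; exists y.
by exists U; split=> //; apply: subset_trans sTU; apply: proper_sub.
Qed.

(** [face_sep] gives a face of rank one below [S'] that avoids [y], so the covering hypothesis makes
    it [S]. With the converse below, unit rank steps are a property of the face lattice alone, which
    is how dimensions pass to vertex sums. *)
Lemma arank_cover S S' : is_face S -> is_face S' -> S \proper S' ->
    (forall T, is_face T -> S \subset T -> T \subset S' -> T = S \/ T = S') ->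
  (arank S).+1 = arank S'.
Proof.
move=> fS fS' /properP[sS [y yS' yS]] cov.
have [T [fT sT sT' yT <-]] := face_sep fS fS' sS yS' yS.
have [->//|eT] := cov T fT sT sT'.
by rewrite eT yS' in yT.
Qed.

Lemma arank_cover_eq S S' T : is_face S -> is_face T ->
    (arank S).+1 = arank S' -> S \subset T -> T \subset S' -> T = S \/ T = S'.
Proof.
move=> fS fT eS sST sTS'.
have [->|nS] := eqVneq T S; first by left.
have [->|nS'] := eqVneq T S'; first by right.
have /(arank_lt fS) l1 : S \proper T by rewrite properEneq eq_sym nS.
have /(arank_lt fT) : T \proper S' by rewrite properEneq nS'.
by rewrite -eS ltnS leqNgt l1.
Qed.

Lemma facet_sep S y : is_face S -> y \notin S ->
  exists F, [/\ is_facet F, S \subset F & y \notin F].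
Proof.
move=> fS yS.
have [F [fF sF _ yF rF]] := face_sep fS is_faceT (subsetT S) (in_setT y) yS.
by exists F; split.
Qed.

Lemma facet_max S T : is_facet S -> is_face T -> S \subset T ->
  T = S \/ T = [set: vertex P]%SET.
Proof. by move=> [fS eS] fT sT; apply: arank_cover_eq => //; apply: subsetT. Qed.

Lemma facet_proper S : is_facet S -> exists y, y \notin S.
Proof.
move=> [_ eS]; apply/existsP; rewrite -negb_forall; apply/negP => /forallP a.
have e : S = [set: vertex P]%SET by apply/setP => i; rewrite a inE.
by rewrite e in eS; move: (n_Sn (arank [set: vertex P]%SET)); rewrite eS.
Qed.

Lemma max_facet S y : is_face S -> y \notin S ->
    (forall T, is_face T -> S \subset T -> T = S \/ T = [set: vertex P]%SET) ->
  is_facet S.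
Proof.
move=> fS yS mS; split=> //; apply: arank_cover => //; first exact: is_faceT.
  by apply/properP; split; [exact: subsetT | exists y].
by move=> T fT sT _; apply: mS.
Qed.

Definition mkfacet S (fS : is_facet S) : facet P := exist _ S (asboolT fS).

Lemma facetP (F : facet P) : is_facet (val F).
Proof. exact: asboolW (valP F). Qed.

(* A maximal chain of faces from S to S' yields facets and vertices forming a
   triangular submatrix of the slack matrix. *)
Lemma flag S S' : is_face S -> is_face S' -> S \subset S' ->
  exists s : seq (facet P * vertex P),
    [/\ size s = (arank S' - arank S)%N,
        forall e, e \in s ->
          [/\ S \subset val e.1, e.2 \in S' & ~~ incident e.1 e.2]
      & pairwise (fun e1 e2 : facet P * vertex P => incident e2.1 e1.2) s].
Proof.
move=> fS; have [n] := ubnP #|S'|; elim: n S' => // n IHn S' le_n fS' sS.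
have [->|nS] := eqVneq S S'; first by exists [::]; rewrite subnn.
have /properP[_ [y yS' yS]] : S \proper S' by rewrite properEneq nS.
have [T [fT sT sT' yT rT]] := face_sep fS fS' sS yS' yS.
(* [F] contains [T], hence every vertex already chosen, but misses [y]: appending the pair keeps the
   matrix triangular. *)
have [F [fF sF yF]] := facet_sep fT yT.
have [|s [sz sP sT2]] := IHn T _ fT sT.
  rewrite ltnS in le_n; apply: leq_trans le_n; apply: proper_card.
  by apply/properP; split=> //; exists y.
exists (rcons s (mkfacet fF, y)); split.
- by rewrite size_rcons sz -rT subSn // arankS.
- move=> e; rewrite mem_rcons inE => /predU1P[->|/sP[e2 e3 e4]].
    by split=> //; apply: subset_trans sF.
  by split=> //; apply: (subsetP sT').
- rewrite pairwise_rcons sT2 andbT; apply/allP => e /sP[_ eT _].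
  exact: (subsetP sF).
Qed.

End Faces.
(** * Faces of a vertex sum *)

(** What remains of a vertex sum once coordinates are dropped: two vertex sets sharing one point,
    and faces determined by their two traces. Everything after [vertex_sum_glued] uses no other
    information on the sum. *)
Definition glued (R : realFieldType) (a b c : nat) (P : polytope R a)
    (v : vertex P) (Q : polytope R b) (w : vertex Q) (W : polytope R c)
    (iP : vertex P -> vertex W) (iQ : vertex Q -> vertex W) : Prop :=
  [/\ injective iP, injective iQ,
      forall x y, iP x = iQ y <-> x = v /\ y = w,
      forall u, (exists x, u = iP x) \/ (exists y, u = iQ y)
    & forall S, is_face S <-> is_face (iP @^-1: S) /\ is_face (iQ @^-1: S)].

Lemma glued_sym (R : realFieldType) (a b c : nat) (P : polytope R a)
    (v : vertex P) (Q : polytope R b) (w : vertex Q) (W : polytope R c)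
    (iP : vertex P -> vertex W) (iQ : vertex Q -> vertex W) :
  glued v w iP iQ -> glued w v iQ iP.
Proof.
move=> [injP injQ g cov fc]; split=> //.
- by move=> y x; split=> [/esym/g[]|[-> ->]] //; apply/esym/g.
- by move=> u; case: (cov u); [right | left].
- by move=> S; rewrite fc; split=> -[].
Qed.

(** * Affine images of the summands and gluing of affine forms *)

Section AffinePullback.
Variables (R : realFieldType) (a n : nat) (P : polytope R a).
Variables (A : 'M[R]_(a, n)) (s : 'rV[R]_n).
Hypothesis injA : {in aff_span (points P) &, injective (aff_map A s)}.

Definition img (x : vertex P) : 'rV[R]_n := aff_map A s (vert x).

Lemma points_vert (x : vertex P) : points P (vert x).
Proof. by apply: sub_conv_hull; exists x. Qed.

Lemma aff_span_comb (l : vertex P -> R) : \sum_x l x = 1 ->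
  aff_span (points P) (\sum_x l x *: vert x).
Proof.
by move=> l1; exists (nvert P), (@vert R a P), l; split=> // i; apply: points_vert.
Qed.

Lemma aff_map_comb m (y : 'I_m -> 'rV[R]_a) (l : 'I_m -> R) : \sum_i l i = 1 ->
  \sum_i l i *: aff_map A s (y i) = aff_map A s (\sum_i l i *: y i).
Proof.
move=> l1; rewrite /aff_map mulmx_suml.
under eq_bigr do rewrite scalerDr.
rewrite big_split /= -scaler_suml l1 scale1r; congr (_ + _).
by apply: eq_bigr => i _; rewrite scalemxAl.
Qed.

Lemma aff_span_vert (x : vertex P) : aff_span (points P) (vert x).
Proof.
exists 1%N, (fun=> vert x), (fun=> 1).
by split; rewrite ?big_ord1 ?scale1r // => _; apply: points_vert.
Qed.

Lemma vert_inj : injective (@vert R a P).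
Proof.
move=> x y e; have /is_faceP[h [_ hS]] := is_face1 x.
by apply/eqP; rewrite eq_sym -in_set1 hS -e -hS set11.
Qed.

Lemma img_inj : injective img.
Proof.
by move=> x y /injA e; apply/vert_inj/e; apply: mem_set; apply: aff_span_vert.
Qed.

Lemma img_hull x : points P x -> conv_hull (range img) (aff_map A s x).
Proof.
move=> [N [y [c [yP c0 c1 ->]]]]; exists N, (fun i => aff_map A s (y i)), c.
split=> // [i|]; last by rewrite aff_map_comb.
by have [z _ <-] := yP i; exists z.
Qed.

Definition pullback (g : 'cV[R]_(1 + n)) : 'cV[R]_(1 + a) :=
  block_mx 1%:M s 0 A *m g.

Lemma hev_pullback g x : hev (pullback g) x = hev g (aff_map A s x).
Proof.
rewrite /hev /pullback /hom /aff_map mulmxA mul_row_block mulmx0 addr0 mulmx1.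
by rewrite mul1mx addrC.
Qed.

End AffinePullback.

Lemma sum_shift (R : pzRingType) N (i0 : 'I_N) (l : 'I_N -> R) (e : R)
    (V : lmodType R) (f : 'I_N -> V) :
  \sum_i (l i + (if i == i0 then e else 0)) *: f i = \sum_i l i *: f i + e *: f i0.
Proof.
under eq_bigr do rewrite scalerDl.
rewrite big_split /=; congr (_ + _); rewrite (bigD1 i0) //= eqxx big1 ?addr0 //.
by move=> i /negPf ->; rewrite scale0r.
Qed.

Lemma sum_shiftR (R : pzRingType) N (i0 : 'I_N) (l : 'I_N -> R) (e : R) (f : 'I_N -> R) :
  \sum_i (l i + (if i == i0 then e else 0)) * f i = \sum_i l i * f i + e * f i0.
Proof. exact: (@sum_shift R N i0 l e R^o f). Qed.

Section VertexSum.
Variables (R : realFieldType) (a b n : nat) (P : polytope R a) (v : vertex P).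
Variables (Q : polytope R b) (w : vertex Q).
Variables (A : 'M[R]_(a, n)) (s : 'rV[R]_n) (B : 'M[R]_(b, n)) (t : 'rV[R]_n).
Variables (p : 'rV[R]_n) (W : polytope R n).
Let P' : set 'rV[R]_n := (aff_map A s @` points P)%classic.
Let Q' : set 'rV[R]_n := (aff_map B t @` points Q)%classic.
Hypothesis injA : {in aff_span (points P) &, injective (aff_map A s)}.
Hypothesis injB : {in aff_span (points Q) &, injective (aff_map B t)}.
Hypothesis vp : aff_map A s (vert v) = p.
Hypothesis wp : aff_map B t (vert w) = p.
Hypothesis meet : (aff_span P' `&` aff_span Q' = [set p])%classic.
Hypothesis hull : points W = conv_hull (P' `|` Q')%classic.

Local Notation nP := (img (P := P) A s).
Local Notation nQ := (img (P := Q) B t).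

Lemma P'_img x : P' (nP x). Proof. by exists (vert x) => //; apply: points_vert. Qed.
Lemma Q'_img y : Q' (nQ y). Proof. by exists (vert y) => //; apply: points_vert. Qed.

Lemma img_comb_meet (l : vertex P -> R) (m : vertex Q -> R) :
    \sum_x l x = 1 -> \sum_y m y = 1 ->
    \sum_x l x *: nP x = \sum_y m y *: nQ y ->
  \sum_x l x *: nP x = p.
Proof.
move=> l1 m1 e.
suff : aff_span P' (\sum_x l x *: nP x) /\ aff_span Q' (\sum_x l x *: nP x).
  by rewrite -[_ /\ _]/((_ `&` _)%classic _) meet.
split; last rewrite e.
  by exists (nvert P), nP, l; split=> // x; apply: P'_img.
by exists (nvert Q), nQ, m; split=> // y; apply: Q'_img.
Qed.

(** The conditions form a linear system for [g], solvable as soon as the prescribed values respect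
    every linear relation among the homogenized image points. By [img_comb_meet] a relation between
    the two sides reduces to the point [p], where the values agree. *)
Lemma functional_glue (al : 'cV[R]_(1 + a)) (be : 'cV[R]_(1 + b)) :
    hev al (vert v) = hev be (vert w) ->
  exists g : 'cV[R]_(1 + n), (forall x, hev g (nP x) = hev al (vert x)) /\
    (forall y, hev g (nQ y) = hev be (vert y)).
Proof.
move=> agree.
pose Z : 'M[R]_(nvert P + nvert Q, 1 + n) :=
  col_mx (\matrix_x hom (nP x)) (\matrix_y hom (nQ y)).
pose D : 'cV[R]_(nvert P + nvert Q) :=
  col_mx (\col_x hev al (vert x)) (\col_y hev be (vert y)).
suff /submxP[G /(congr1 trmx)] : (D^T <= Z^T)%MS.
  rewrite trmx_mul !trmxK => DE; exists G^T.
  have rowE i : (row i Z *m G^T) 0 0 = D i 0 by rewrite -row_mul -DE mxE.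
  split=> [x|y]; rewrite /hev.
    have := rowE (lshift _ x).
    by rewrite /Z /D rowKu rowK col_mxEu mxE.
  have := rowE (rshift _ y).
  by rewrite /Z /D rowKd rowK col_mxEd mxE.
rewrite submxE; apply/eqP/rowP => j; rewrite [RHS]mxE.
have : Z^T *m col j (cokermx Z^T) = 0.
  by rewrite colE mulmxA mulmx_coker mul0mx.
have -> : (D^T *m cokermx Z^T) 0 j = ((col j (cokermx Z^T))^T *m D) 0 0.
  move: (cokermx _) => C; rewrite [LHS]mxE [RHS]mxE; apply: eq_bigr => i _.
  by rewrite [D^T _ _]mxE [(col _ _)^T _ _]mxE [col _ _ _ _]mxE mulrC.
move: (col j _) => k /(congr1 trmx); rewrite trmx_mul trmxK trmx0.
set K := k^T; rewrite -[K]hsubmxK /Z /D mul_row_col mul_row_col.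
move: (lsubmx K) (rsubmx K) => l m {K} Z0.
have rowsE N (f : 'I_N -> 'rV[R]_n) (u : 'rV[R]_N) :
    u *m (\matrix_x hom (f x)) = row_mx (\sum_x u 0 x)%:M (\sum_x u 0 x *: f x).
  rewrite -hom_sum mulmx_sum_row; apply: eq_bigr => x _.
  by rewrite rowK.
move: Z0; rewrite !rowsE add_row_mx -row_mx0 => /eq_row_mx[/matrixP/(_ 0 0)].
rewrite !mxE !mulr1n => tau e.
set T := \sum_x l 0 x in tau.
have tauQ : \sum_y m 0 y = - T by apply/eqP; rewrite -addr_eq0 addrC tau.
(* [l] has total weight [T] and [m] has [- T]. Adding [1 - T] to [l] at [v] and to [- m] at [w]
   turns the relation into an equality of affine combinations of the two sides, which must be
   [p]. *)
pose l' x := l 0 x + (if x == v then 1 - T else 0).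
pose m' y := - m 0 y + (if y == w then 1 - T else 0).
have l1 : \sum_x l' x = 1.
  have := sum_shiftR v (l 0) (1 - T) (fun=> 1); rewrite mulr1.
  under eq_bigr do rewrite mulr1; move=> ->.
  by under eq_bigr do rewrite mulr1; rewrite -/T addrC subrK.
have m1 : \sum_y m' y = 1.
  have := sum_shiftR w (fun y => - m 0 y) (1 - T) (fun=> 1); rewrite mulr1.
  under eq_bigr do rewrite mulr1; move=> ->.
  by under eq_bigr do rewrite mulr1; rewrite sumrN tauQ opprK addrC subrK.
have sm (f : vertex Q -> 'rV[R]_n) : \sum_y - m 0 y *: f y = - \sum_y m 0 y *: f y.
  by rewrite -sumrN; apply: eq_bigr => y _; rewrite scaleNr.
have vw : nP v = nQ w by rewrite /img vp wp.
have elm : \sum_x l' x *: nP x = \sum_y m' y *: nQ y.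
  rewrite !sum_shift vw sm; congr (_ + _).
  by apply/eqP; rewrite -addr_eq0 e.
have elp := img_comb_meet l1 m1 elm.
have lv : \sum_x l' x *: vert x = vert v.
  apply: injA; [apply: mem_set; exact: aff_span_comb|apply: mem_set; exact: aff_span_vert|].
  by rewrite -aff_map_comb // vp.
have mw : \sum_y m' y *: vert y = vert w.
  apply: injB; [apply: mem_set; exact: aff_span_comb|apply: mem_set; exact: aff_span_vert|].
  by rewrite -aff_map_comb // wp -elp elm.
have := congr1 (hev al) lv; rewrite hev_comb // sum_shiftR => el.
have := congr1 (hev be) mw; rewrite hev_comb // sum_shiftR => em.
under eq_bigr do rewrite [in X in _ * X]mxE.
under [X in _ + X]eq_bigr do rewrite [in X in _ * X]mxE.
have em' : \sum_y - m 0 y * hev be (vert y) = - \sum_y m 0 y * hev be (vert y).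
  by rewrite -sumrN; apply: eq_bigr => y _; rewrite mulNr.
have solve (x y : R) : x + (1 - T) * y = y -> x = T * y.
  move=> h; rewrite -[LHS](addrK ((1 - T) * y)) h mulrBl mul1r opprB.
  by rewrite addrC subrK.
rewrite em' in em; rewrite (solve _ _ el) agree -(solve _ _ em).
by rewrite addNr.
Qed.

Lemma points_nP x : points W (nP x).
Proof. by rewrite hull; apply: sub_conv_hull; left; apply: P'_img. Qed.

Lemma points_nQ y : points W (nQ y).
Proof. by rewrite hull; apply: sub_conv_hull; right; apply: Q'_img. Qed.

Lemma sum_gt0 g : (forall x, 0 < hev g (nP x)) ->
  (forall y, 0 < hev g (nQ y)) -> forall z, points W z -> 0 < hev g z.
Proof.
move=> gP gQ z; rewrite hull; apply: conv_hull_gt0 => _ [] [u /img_hull hu <-];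
  by apply: conv_hull_gt0 (hu _ _ _) => _ [i _ <-].
Qed.

Lemma sum_exposes g z :
    exposes g z (range nP) -> exposes g z (range nQ) -> exposes g z (points W).
Proof.
move=> gP gQ; rewrite hull; apply: conv_hull_exposes => _ [] [u /img_hull hu <-].
  exact: conv_hull_exposes gP _ (hu _ _ _).
exact: conv_hull_exposes gQ _ (hu _ _ _).
Qed.

(* A functional exposing the point z must vanish at some vertex of W. *)
Lemma exposed_vert g z :
    exposes g z (range nP) -> exposes g z (range nQ) -> hev g z = 0 ->
  points W z -> exists u : vertex W, vert u = z.
Proof.
move=> gP gQ gz Wz; have gW := sum_exposes gP gQ.
have [/existsP[u /eqP gu]|] := boolP [exists u : vertex W, hev g (vert u) == 0].
  by exists u; have [_ ->] := gW _ (points_vert u).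
rewrite negb_exists => /forallP nz.
suff : 0 < hev g z by rewrite gz ltxx.
apply: conv_hull_gt0 Wz => _ [u _ <-].
by rewrite lt0r nz; have [] := gW _ (points_vert u).
Qed.

(** A form exposing [x] on [P] is extended to [Q] by a form exposing [w] if [x] is [v], and
    otherwise by the constant it takes at [v], which is positive; the glued form exposes the image
    of [x]. *)
Lemma nP_vert x : exists u : vertex W, vert u = nP x.
Proof.
have /is_faceP[al [al0 alS]] := is_face1 x.
have vw : nP v = nQ w by rewrite /img vp wp.
have : exists be : 'cV[R]_(1 + b),
    [/\ hev al (vert v) = hev be (vert w), forall y : vertex Q, 0 <= hev be (vert y)
      & forall y : vertex Q, hev be (vert y) = 0 -> x = v /\ y = w].
  have [xv|xv] := eqVneq x v.
    subst x.
    have /is_faceP[be [be0 beS]] := is_face1 w; exists be; split.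
      have /eqP-> : hev al (vert v) == 0 by rewrite -alS set11.
      by have /eqP-> : hev be (vert w) == 0 by rewrite -beS set11.
      exact: be0.
    by move=> y /eqP; rewrite -beS => /set1P ->.
  exists (col_mx (hev al (vert v))%:M 0).
  split=> [|y|y]; rewrite hev_const // => /eqP; rewrite -alS => /set1P e.
  by rewrite e eqxx in xv.
case=> be [bv be0 bew]; have [g [gP gQ]] := functional_glue bv.
apply: (exposed_vert (g := g)) (points_nP x).
- move=> _ [y _ <-]; rewrite gP; split=> // /eqP; rewrite -alS.
  by move=> /set1P ->.
- move=> _ [y _ <-]; rewrite gQ; split=> // /bew[-> ->].
  by rewrite vw.
- by rewrite gP; apply/eqP; rewrite -alS set11.
Qed.

(** A form exposing [u] vanishes at [u], so it cannot be positive at all image points; an image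
    point where it vanishes is [u]. *)
Lemma vert_img (u : vertex W) : (exists x, vert u = nP x) \/ (exists y, vert u = nQ y).
Proof.
have /is_faceP[g [g0 gS]] := is_face1 u.
have gW : exposes g (vert u) (points W).
  apply: conv_hull_exposes => _ [i _ <-]; split=> // /eqP; rewrite -gS.
  by move=> /set1P ->.
have gu : hev g (vert u) = 0 by apply/eqP; rewrite -gS set11.
have [/existsP[x /eqP gx]|] := boolP [exists x, hev g (nP x) == 0].
  by left; exists x; have [_ ->] := gW _ (points_nP x).
have [/existsP[y /eqP gy] _|] := boolP [exists y, hev g (nQ y) == 0].
  by right; exists y; have [_ ->] := gW _ (points_nQ y).
rewrite !negb_exists => /forallP nQ0 /forallP nP0.
suff : 0 < hev g (vert u) by rewrite gu ltxx.
apply: sum_gt0 (points_vert u) => i; rewrite lt0r ?nQ0 ?nP0.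
  by have [] := gW _ (points_nP i).
by have [] := gW _ (points_nQ i).
Qed.

Lemma nP_nQ x y : nP x = nQ y -> x = v /\ y = w.
Proof.
move=> e; have ep : nP x = p.
  have := @img_comb_meet (fun i => (i == x)%:R) (fun j => (j == y)%:R).
  have s1 N (i0 : 'I_N) (V : lmodType R) (f : 'I_N -> V) :
      \sum_i (i == i0)%:R *: f i = f i0.
    rewrite (bigD1 i0) //= eqxx scale1r big1 ?addr0 // => i /negPf ->.
    by rewrite scale0r.
  have s2 N (i0 : 'I_N) : \sum_i (i == i0)%:R = 1 :> R.
    by rewrite (bigD1 i0) //= eqxx big1 ?addr0 // => i /negPf ->.
  by rewrite !s1 !s2; apply.
split; first by apply: (img_inj injA); rewrite ep /img vp.
by apply: (img_inj injB); rewrite -e ep /img wp.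
Qed.

End VertexSum.

(** Vertices are the minimal nonempty faces: for [j] in the image of [[set i]], the face [[set j]]
    pulls back into [[set i]], and not to the empty face. *)
Lemma face_iso_atoms (R : realFieldType) (m n : nat)
    (P : polytope R m) (Q : polytope R n)
    (f : {set vertex P} -> {set vertex Q}) (g : {set vertex Q} -> {set vertex P}) :
    (forall S, is_face S -> is_face (f S) /\ g (f S) = S) ->
    (forall T, is_face T -> is_face (g T) /\ f (g T) = T) ->
    (forall S S', is_face S -> is_face S' -> (f S \subset f S') = (S \subset S')) ->
  forall i, exists j, f [set i] = [set j].
Proof.
move=> fP gP fS i; have f0 : f set0 = set0.
  have [g0 e0] := gP set0 (is_face0 Q).
  have := fS set0 (g set0) (is_face0 P) g0.
  by rewrite e0 sub0set subset0 => /eqP.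
have [/eqP|[j jf]] := set_0Vmem (f [set i]).
  have [_ ei] := fP _ (is_face1 i); have [_ e0] := fP _ (is_face0 P).
  move/eqP=> e; have := set11 i; rewrite -ei e -f0 e0 inE //.
exists j; have [gj ej] := gP _ (is_face1 j).
have : g [set j] \subset [set i].
  by rewrite -(fS _ _ gj (is_face1 i)) ej sub1set.
rewrite subset1 => /orP[/eqP e|/eqP e]; first by rewrite -e ej.
by have := set11 j; rewrite -ej e f0 inE.
Qed.

Lemma comb_equiv_vert (R : realFieldType) (m n : nat)
    (P : polytope R m) (Q : polytope R n) : comb_equiv P Q ->
  exists (r : vertex P -> vertex Q) (r' : vertex Q -> vertex P),
    [/\ cancel r r', cancel r' r
      & forall S : {set vertex Q}, is_face S <-> is_face (r @^-1: S)].
Proof.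
move=> [f [g [fP gP fS]]].
have gS T T' : is_face T -> is_face T' -> (g T \subset g T') = (T \subset T').
  move=> fT fT'; have [gT eT] := gP T fT; have [gT' eT'] := gP T' fT'.
  by rewrite -(fS _ _ gT gT') eT eT'.
have [r rE] := choice (face_iso_atoms fP gP fS).
have [r' r'E] := choice (face_iso_atoms gP fP gS).
have rK : cancel r r'.
  move=> i; apply/esym/set1P; rewrite -r'E -rE.
  by have [_ ->] := fP _ (is_face1 i); rewrite set11.
have r'K : cancel r' r.
  move=> i; apply/esym/set1P; rewrite -rE -r'E.
  by have [_ ->] := gP _ (is_face1 i); rewrite set11.
have fE S : is_face S -> r @^-1: f S = S.
  move=> fcS; apply/setP => i; rewrite inE -sub1set -rE fS ?sub1set //.
  exact: is_face1.
exists r, r'; split=> // S; split=> fcS.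
  by have [gcS <-] := gP S fcS; rewrite fE.
have [ff _] := fP _ fcS.
suff -> : S = f (r @^-1: S) by [].
by apply/setP => j; have := fE _ fcS => /setP/(_ (r' j)); rewrite !inE r'K.
Qed.

(** The vertices of [W0] are the image points, and [comb_equiv_vert] relabels them as vertices of
    [W]. Forms on the sum pull back to the summands; conversely [functional_glue] joins two
    forms. *)
Lemma vertex_sum_glued (R : realFieldType) (a b c : nat)
    (P : polytope R a) (v : vertex P) (Q : polytope R b) (w : vertex Q)
    (W : polytope R c) : is_vertex_sum v w W ->
  exists (iP : vertex P -> vertex W) (iQ : vertex Q -> vertex W), glued v w iP iQ.
Proof.
move=> [A [s [B [t [p [W0 /= [injA injB [vp wp] meet [hull cW]]]]]]]].
have [r [r' [rK r'K rF]]] := comb_equiv_vert cW.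
have meet' : (aff_span (aff_map B t @` points Q) `&`
    aff_span (aff_map A s @` points P) = [set p])%classic.
  by rewrite classical_sets.setIC.
have hull' : points W0 =
    conv_hull ((aff_map B t @` points Q) `|` (aff_map A s @` points P))%classic.
  by rewrite classical_sets.setUC.
have [jP jPE] := choice (nP_vert injA injB vp wp meet hull).
have [jQ jQE] := choice (nP_vert injB injA wp vp meet' hull').
have jPinj : injective jP.
  by move=> x y e; apply: (img_inj injA); rewrite -!jPE e.
have jQinj : injective jQ.
  by move=> x y e; apply: (img_inj injB); rewrite -!jQE e.
have vw : jP v = jQ w by apply: vert_inj; rewrite jPE jQE /img vp wp.
have cov u : (exists x, u = jP x) \/ (exists y, u = jQ y).
  have [[x e]|[y e]] := vert_img hull u; [left; exists x|right; exists y];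
  by apply: vert_inj; rewrite e ?jPE ?jQE.
exists (r \o jP), (r \o jQ); split.
- exact: inj_comp (can_inj rK) jPinj.
- exact: inj_comp (can_inj rK) jQinj.
- move=> x y; split=> [/(can_inj rK) e|[-> ->]]; last by rewrite /= vw.
  by apply: (nP_nQ injA injB vp wp meet); rewrite -jPE -jQE e.
- move=> u; have [[x e]|[y e]] := cov (r' u); [left; exists x|right; exists y];
  by rewrite /= -e r'K.
move=> S; rewrite rF.
have compE (n : nat) (X : polytope R n) (j : vertex X -> vertex W0) :
    (r \o j) @^-1: S = j @^-1: (r @^-1: S).
  by apply/setP => i; rewrite !inE.
rewrite (compE _ _ jP) (compE _ _ jQ); move: (r @^-1: S) => {compE} {}S; split.
  move=> /is_faceP[g [g0 gS]]; split; apply/is_faceP.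
    exists (pullback A s g); split=> i; rewrite hev_pullback -/(img A s i) -jPE.
      exact: g0.
    by rewrite inE gS.
  exists (pullback B t g); split=> i; rewrite hev_pullback -/(img B t i) -jQE.
    exact: g0.
  by rewrite inE gS.
move=> [/is_faceP[al [al0 alS]] /is_faceP[be [be0 beS]]].
(* At the common vertex both values are zero or both are positive; in the second case each form is
   scaled by the value of the other. *)
have [al' [be' [agree [al'0 al'S] [be'0 be'S]]]] :
    exists (al' : 'cV[R]_(1 + a)) (be' : 'cV[R]_(1 + b)),
    [/\ hev al' (vert v) = hev be' (vert w),
      (forall x : vertex P, 0 <= hev al' (vert x)) /\
      (forall x : vertex P, (jP x \in S) = (hev al' (vert x) == 0))
    & (forall y : vertex Q, 0 <= hev be' (vert y)) /\
      (forall y : vertex Q, (jQ y \in S) = (hev be' (vert y) == 0))].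
  have alS' x : (jP x \in S) = (hev al (vert x) == 0) by rewrite -alS inE.
  have beS' x : (jQ x \in S) = (hev be (vert x) == 0) by rewrite -beS inE.
  have e : (hev al (vert v) == 0) = (hev be (vert w) == 0).
    by rewrite -alS' -beS' vw.
  have [al_v|al_v] := eqVneq (hev al (vert v)) 0.
    exists al, be; split=> //; rewrite al_v; apply/esym/eqP.
    by rewrite -e al_v.
  have be_w : hev be (vert w) != 0 by rewrite -e.
  exists (hev be (vert w) *: al), (hev al (vert v) *: be); split.
  - by rewrite !hevZ mulrC.
  - by split=> x; rewrite hevZ ?mulr_ge0 // mulf_eq0 (negPf be_w) alS'.
  - by split=> x; rewrite hevZ ?mulr_ge0 // mulf_eq0 (negPf al_v) beS'.
have [g [gP gQ]] := functional_glue injA injB vp wp meet agree.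
apply/is_faceP; exists g; split=> u; case: (cov u) => -[i ->];
  by rewrite ?jPE ?jQE ?gP ?gQ ?al'S ?be'S.
Qed.

(** * Facets and dimension of a glued polytope *)

Section GluedFaces.
Variables (R : realFieldType) (a b c : nat) (P : polytope R a) (v : vertex P).
Variables (Q : polytope R b) (w : vertex Q) (W : polytope R c).
Variables (iP : vertex P -> vertex W) (iQ : vertex Q -> vertex W).
Hypothesis gl : glued v w iP iQ.
Implicit Types (S : {set vertex P}) (T : {set vertex Q}) (H : {set vertex W}).

Definition glue S T : {set vertex W} := iP @: S :|: iQ @: T.

Lemma glued_pt : iP v = iQ w.
Proof. by have [_ _ g _ _] := gl; apply/g. Qed.

Lemma trace_pt H : (v \in iP @^-1: H) = (w \in iQ @^-1: H).
Proof. by rewrite !inE glued_pt. Qed.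

Lemma preim_glue S T : (v \in S) = (w \in T) ->
  iP @^-1: glue S T = S /\ iQ @^-1: glue S T = T.
Proof.
have [injP injQ g _ _] := gl.
move=> vw; split; apply/setP => x; rewrite !inE mem_imset // ?orbF.
  apply/orP/idP => [[//|/imsetP[y yT /g[-> yw]]]|->]; last by left.
  by rewrite vw -yw.
apply/orP/idP => [[/imsetP[y yS /esym/g[yv ->]]|//]|->]; last by right.
by rewrite -vw -yv.
Qed.

Lemma sub_trace H H' : (H \subset H') =
  (iP @^-1: H \subset iP @^-1: H') && (iQ @^-1: H \subset iQ @^-1: H').
Proof.
have [_ _ _ cov _] := gl; apply/idP/andP => [s|[sP sQ]].
  by split; apply: preimsetS.
apply/subsetP => u; case: (cov u) => -[x ->] xH.
  by have := subsetP sP x; rewrite !inE => /(_ xH).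
by have := subsetP sQ x; rewrite !inE => /(_ xH).
Qed.

Lemma trace_inj H H' : iP @^-1: H = iP @^-1: H' -> iQ @^-1: H = iQ @^-1: H' ->
  H = H'.
Proof. by move=> eP eQ; apply/eqP; rewrite eqEsubset !sub_trace eP eQ !subxx. Qed.

Lemma face_trace H : is_face H -> is_face (iP @^-1: H) /\ is_face (iQ @^-1: H).
Proof. by have [_ _ _ _ f] := gl => /f. Qed.

Lemma face_glue S T : is_face S -> is_face T -> (v \in S) = (w \in T) ->
  is_face (glue S T).
Proof.
have [_ _ _ _ f] := gl; move=> fS fT vw; apply/f.
by have [-> ->] := preim_glue vw.
Qed.

Lemma sub_glue H S T : (v \in S) = (w \in T) -> iP @^-1: H \subset S ->
  iQ @^-1: H \subset T -> H \subset glue S T.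
Proof. by move=> vw sS sT; rewrite sub_trace; have [-> ->] := preim_glue vw; rewrite sS. Qed.

(** If the trace on [P] is proper, enlarge it to a facet through [v], glued with all of [Q], or
    enlarge both traces to facets avoiding the common vertex. The glued face is proper and contains
    [H], so it is [H] by maximality. *)
Lemma facet_trace H : is_facet H ->
  [\/ iP @^-1: H = [set: vertex P],
      is_facet (iP @^-1: H) /\ iQ @^-1: H = [set: vertex Q]
    | [/\ is_facet (iP @^-1: H), is_facet (iQ @^-1: H) & v \notin iP @^-1: H]].
Proof.
move=> fH; have [fP fQ] := face_trace (proj1 fH).
have [|nT] := eqVneq (iP @^-1: H) [set: vertex P]; first by constructor 1.
have [y yH] : exists y, y \notin iP @^-1: H.
  apply/existsP; rewrite -negb_forall; apply: contra nT => /forallP aH.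
  by apply/eqP/setP => i; rewrite [RHS]inE aH.
have [vH|vH] := boolP (v \in iP @^-1: H).
  have [F [fF sF yF]] := facet_sep fP yH.
  have vw : (v \in F) = (w \in [set: vertex Q]) by rewrite inE (subsetP sF).
  have [eP eQ] := preim_glue vw.
  have [e|e] : glue F [set: vertex Q] = H \/ glue F [set: vertex Q] = [set: vertex W].
  - apply: facet_max fH _ _; first exact: face_glue (proj1 fF) (is_faceT Q) vw.
    by apply: sub_glue => //; apply: subsetT.
  - by constructor 2; rewrite -e eP.
  by move: yF; rewrite -eP e !inE.
have [F [fF sF vF]] := facet_sep fP vH.
have wH : w \notin iQ @^-1: H by rewrite -trace_pt.
have [G [fG sG wG]] := facet_sep fQ wH.
have vw : (v \in F) = (w \in G) by rewrite (negPf vF) (negPf wG).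
have [eP eQ] := preim_glue vw.
have [e|e] : glue F G = H \/ glue F G = [set: vertex W].
- apply: facet_max fH _ _; first exact: face_glue (proj1 fF) (proj1 fG) vw.
  exact: sub_glue.
- by constructor 3; rewrite -e eP eQ.
by move: vF; rewrite -eP e !inE.
Qed.

(** Over [S] take all of [Q] if [v] is in [S], and otherwise a facet of [Q] avoiding [w]. The traces
    of a larger face agree about the common vertex, which leaves only the glued face itself and all
    of [W]. *)
Lemma lift_facet S : is_facet S ->
  exists H, [/\ is_facet H, iP @^-1: H = S
    & v \in S -> iQ @^-1: H = [set: vertex Q]].
Proof.
move=> fS; have [y yS] := facet_proper fS.
have [T [fT vw mT vT]] : exists T, [/\ is_face T, (v \in S) = (w \in T),
    forall T', is_face T' -> T \subset T' -> T' = T \/ T' = [set: vertex Q]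
  & v \in S -> T = [set: vertex Q]].
  have [vS|vS] := boolP (v \in S).
    exists [set: vertex Q]; split; rewrite ?inE //; first exact: is_faceT.
    by move=> T' _; rewrite subTset => /eqP; left.
  have [|T [fT _ wT]] := @facet_sep _ _ Q set0 w (is_face0 Q); first by rewrite inE.
  exists T; split=> //; [exact: proj1 fT | by rewrite (negPf wT) |].
  by move=> T' fT'; apply: facet_max.
have [eP eQ] := preim_glue vw.
exists (glue S T); split=> //; last by move=> /vT eT; rewrite eQ.
apply: (@max_facet _ _ _ _ (iP y)); first exact: face_glue (proj1 fS) fT vw.
  by move: yS; rewrite -{1}eP inE.
move=> H fH; rewrite sub_trace eP eQ => /andP[sS sT].
have [fHP fHQ] := face_trace fH.
have := trace_pt H.
have [eS|eS] := facet_max fS fHP sS; have [eT|eT] := mT _ fHQ sT.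
- by left; apply: trace_inj; rewrite ?eP ?eQ.
- rewrite eS eT inE => /vT eT'; left; apply: trace_inj; rewrite ?eP ?eQ //.
  by rewrite eT.
- rewrite eS eT inE => /esym; rewrite -vw => /vT eT'.
  by right; apply: trace_inj; rewrite ?eS ?eT ?eT' preimsetT.
- by right; apply: trace_inj; rewrite ?eS ?eT preimsetT.
Qed.

(** Induction down a chain of faces from [S] to [[set v]]: gluing [T] to both ends of a cover in [P]
    gives a cover in [W], so both ranks drop by one together. *)
Lemma arank_glue S T : is_face S -> is_face T -> v \in S -> w \in T ->
  (arank (glue S T)).+1 = (arank S + arank (glue [set v] T))%N.
Proof.
have [n] := ubnP #|S|; elim: n S => // n IHn S le_n fS fT vS wT.
have [->|nS] := eqVneq S [set v]; first by rewrite arank1.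
have sv : [set v] \subset S by rewrite sub1set.
have /properP[_ [y yS yv]] : [set v] \proper S by rewrite properEneq eq_sym nS.
have [U [fU sU sUS yU rU]] := face_sep (is_face1 v) fS sv yS yv.
have vU : v \in U by rewrite -sub1set.
rewrite -rU addSn -IHn //; last first.
  rewrite ltnS in le_n; apply: leq_trans le_n; apply: proper_card.
  by apply/properP; split=> //; exists y.
congr _.+1; apply/esym.
have vwS : (v \in S) = (w \in T) by rewrite vS wT.
have vwU : (v \in U) = (w \in T) by rewrite vU wT.
have [eP eQ] := preim_glue vwS; have [eP' eQ'] := preim_glue vwU.
apply: arank_cover; [exact: face_glue|exact: face_glue| |].
  apply/properP; split; first by rewrite sub_trace eP eP' eQ eQ' sUS subxx.
  by exists (iP y); [move: yS; rewrite -{1}eP inE | move: yU; rewrite -{1}eP' inE].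
move=> H fH; rewrite !sub_trace eP eP' eQ eQ' => /andP[s1 s2] /andP[s3 s4].
have [fHP fHQ] := face_trace fH.
have eHQ : iQ @^-1: H = T by apply/eqP; rewrite eqEsubset s2 s4.
by have [e|e] := arank_cover_eq fU fHP rU s1 s3; [left|right];
  apply: trace_inj; rewrite ?eHQ ?e.
Qed.

End GluedFaces.

Lemma pdim_glued (R : realFieldType) (a b c : nat) (P : polytope R a)
    (v : vertex P) (Q : polytope R b) (w : vertex Q) (W : polytope R c)
    (iP : vertex P -> vertex W) (iQ : vertex Q -> vertex W) :
  glued v w iP iQ -> pdim W = (pdim P + pdim Q)%N.
Proof.
move=> gl; have gl' := glued_sym gl.
have := arank_glue gl (is_faceT P) (is_faceT Q) (in_setT v) (in_setT w).
have := arank_glue gl' (is_faceT Q) (is_face1 v) (in_setT w) (set11 v).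
have -> : glue iQ iP [set w] [set v] = [set iP v].
  by rewrite /glue !imset_set1 -(glued_pt gl) setUid.
have -> : glue iQ iP [set: vertex Q] [set v] = glue iP iQ [set v] [set: vertex Q].
  by rewrite /glue setUC.
have -> : glue iP iQ [set: vertex P] [set: vertex Q] = [set: vertex W].
  have [_ _ _ cov _] := gl; apply/setP => u; rewrite !inE.
  by case: (cov u) => -[x ->]; rewrite imset_f ?orbT.
rewrite arank1 !arankT addn1 => -[->]; rewrite addSn => -[].
by rewrite addnS => -[->].
Qed.
(** * Binomials of the non-incidence graph *)

Section IdealTheory.
Variable A : comNzRingType.
Implicit Types (I G : set A) (f g x : A).

Definition is_ideal I :=
  [/\ I 0, forall f g, I f -> I g -> I (f + g) & forall r f, I f -> I (r * f)].

Lemma ideal_gen_ideal G : is_ideal (ideal_gen G).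
Proof.
split.
- by exists [::]; split=> //; rewrite big_nil.
- move=> _ _ [s [sG ->]] [t [tG ->]]; exists (s ++ t); rewrite big_cat; split=> // e.
  by rewrite mem_cat => /orP[/sG|/tG].
- move=> r _ [s [sG ->]]; exists [seq (r * e.1, e.2) | e <- s]; split.
    by move=> _ /mapP[e /sG es ->].
  by rewrite big_map mulr_sumr; apply: eq_bigr => e _; rewrite mulrA.
Qed.

Lemma sub_ideal_gen G f : G f -> ideal_gen G f.
Proof.
move=> Gf; exists [:: (1, f)]; rewrite big_seq1 mul1r; split=> // e.
by rewrite inE => /eqP ->.
Qed.

Lemma ideal_gen_min G I : is_ideal I -> (forall f, G f -> I f) ->
  forall f, ideal_gen G f -> I f.
Proof.
move=> [I0 ID IM] GI _ [s [sG ->]]; rewrite big_seq.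
by apply: big_ind => // e /sG/GI; apply: IM.
Qed.

Lemma idealN I f : is_ideal I -> I f -> I (- f).
Proof. by move=> [_ _ IM] /IM => /(_ (-1)); rewrite mulN1r. Qed.

Lemma saturation_ideal I x : is_ideal I -> is_ideal (saturation I x).
Proof.
move=> [I0 ID IM]; split.
- by exists 0%N; rewrite mulr0.
- move=> f g [n nf] [p pg]; exists (n + p)%N; rewrite mulrDr exprD.
  by apply: ID; [rewrite mulrAC mulrC | rewrite -mulrA]; apply: IM.
- by move=> r f [n nf]; exists n; rewrite mulrCA; apply: IM.
Qed.

Lemma sub_saturation I x f : I f -> saturation I x f.
Proof. by exists 0%N; rewrite expr0 mul1r. Qed.

Lemma saturation_cancel I x n r f : is_ideal I -> saturation I x (r * f) ->
  (exists s, s * r = x ^+ n) -> saturation I x f.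
Proof.
move=> [_ _ IM] [p pf] [s sr]; exists (n + p)%N.
by rewrite exprD -sr -!mulrA [r * _]mulrCA; apply: IM.
Qed.

End IdealTheory.

Section CyclicProducts.
Variables (A : comNzRingType) (T : eqType).
Implicit Types (l : T -> T -> A) (C s : seq T).

Fixpoint path_prod l x s : A := if s is y :: s' then l x y * path_prod l y s' else 1.

Lemma path_prod_cat l x s y s' :
  path_prod l x (s ++ y :: s') = path_prod l x (rcons s y) * path_prod l y s'.
Proof. by elim: s x => [|z s IHs] x /=; rewrite ?mulr1 // IHs mulrA. Qed.

Lemma path_prod_rcons l x s z :
  path_prod l x (rcons s z) = path_prod l x s * l (last x s) z.
Proof. by elim: s x => [|y s IHs] x /=; rewrite ?mulr1 ?mul1r // IHs mulrA. Qed.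

Lemma path_prodE l x0 x s :
  path_prod l x s = \prod_(i < size s) l (nth x0 (x :: s) i) (nth x0 s i).
Proof.
by elim: s x => [|y s IHs] x; rewrite ?big_ord0 //= big_ord_recl IHs.
Qed.

Lemma cycle_prodE l x s : uniq (x :: s) ->
  \prod_(z <- x :: s) l z (next (x :: s) z) = path_prod l x (rcons s x).
Proof.
move=> us; rewrite (path_prodE _ x) size_rcons (big_nth x) big_mkord.
apply: eq_bigr => i _; have lti : (i < size (x :: s))%N := ltn_ord i.
rewrite -rcons_cons nth_rcons lti next_nth mem_nth // index_uniq // nth_rcons.
case: (ltnP i (size s)) => // ge.
by rewrite [nth x s i]nth_default // if_same.
Qed.

Lemma prod_next (M : Type) (idx : M) (op : Monoid.com_law idx) C (h : T -> M) :
  uniq C -> \big[op/idx]_(z <- C) h (next C z) = \big[op/idx]_(z <- C) h z.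
Proof.
move=> uC; rewrite -(big_map (next C) xpredT h); apply: perm_big.
have inj : injective (next C) by apply: can_inj (prev_next uC).
apply: uniq_perm => // [|z]; first by rewrite map_inj_uniq.
apply/mapP/idP => [[t tC ->]|zC]; first by rewrite mem_next.
by exists (prev C z); rewrite ?mem_prev // next_prev.
Qed.

End CyclicProducts.

Section Monomials.
Variables (k : fieldType) (R : realFieldType) (d : nat) (P : polytope R d).
Local Notation Fc := (facet P).
Local Notation Vx := (vertex P).
Local Notation node := (Fc + Vx)%type.
Local Notation ring := (slack_ring k P).
Local Notation adj := (@nonincidence_graph R d P).
Local Notation lab := (@label k R d P).
Implicit Types (x : Fc) (y : Vx) (m : Fc -> Vx -> nat).

(** Unlike in [slack_mx], the default at incident pairs is 1, so that products of powers are
    monomials whatever the exponents there. *)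
Definition zvar x y : ring :=
  if insub (x, y) is Some e then 'X_(enum_rank (e : nonincident_pair P)) else 1.

Lemma slack_mxE x y : slack_mx k x y = if incident x y then 0 else zvar x y.
Proof.
by rewrite /slack_mx /zvar; case: insubP => /= [e /negPf ->|/negPn ->].
Qed.

Definition monX m : ring := \prod_x \prod_y zvar x y ^+ m x y.

Lemma eq_monX m m' : m =2 m' -> monX m = monX m'.
Proof. by move=> e; do 2!apply: eq_bigr => ? _; rewrite e. Qed.

Lemma monXD m m' : monX (fun x y => m x y + m' x y)%N = monX m * monX m'.
Proof.
rewrite -big_split; apply: eq_bigr => x _; rewrite -big_split.
by apply: eq_bigr => y _; rewrite exprD.
Qed.

Lemma monX0 : monX (fun _ _ => 0%N) = 1.
Proof. by rewrite /monX big1 // => x _; rewrite big1. Qed.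

Lemma monX_sum (J : Type) (r : seq J) (F : J -> Fc -> Vx -> nat) :
  monX (fun x y => \sum_(j <- r) F j x y)%N = \prod_(j <- r) monX (F j).
Proof.
elim: r => [|j r IHr].
  by rewrite big_nil -monX0; apply: eq_monX => x y; rewrite big_nil.
by rewrite big_cons -IHr -monXD; apply: eq_monX => x y; rewrite big_cons.
Qed.

Definition delta x y : Fc -> Vx -> nat := fun x' y' => (x == x') && (y == y').

Lemma monX_delta x y : monX (delta x y) = zvar x y.
Proof.
rewrite /monX (bigD1 x) //= (bigD1 y) //= /delta !eqxx expr1 !big1 ?mulr1 //.
  by move=> x' /negPf n; rewrite big1 // => y' _; rewrite eq_sym n.
by move=> y' /negPf n; rewrite eq_sym n.
Qed.

Definition supported m := forall x y, incident x y -> m x y = 0%N.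
Definition balanced m m' :=
  (forall x, \sum_y m x y = \sum_y m' x y)%N /\
  (forall y, \sum_x m x y = \sum_x m' x y)%N.

Definition edge (s t : node) x y : nat := (s == inl x) && (t == inr y).

Lemma label_monX s t : adj s t -> lab s t = monX (edge s t).
Proof.
case: s t => [x|y] [x'|y'] //= a.
  by rewrite slack_mxE (negPf a) -monX_delta; apply: eq_monX.
by rewrite -monX0; apply: eq_monX.
Qed.

Lemma adj_sym : symmetric adj. Proof. by case=> ? [?|?]. Qed.

Definition fwd C x y : nat := (\sum_(t <- C) edge t (next C t) x y)%N.
Definition bwd C x y : nat := (\sum_(t <- C) edge (next C t) t x y)%N.

Lemma cycle_binomialE C : ucycle adj C ->
  cycle_binomial k C = monX (fwd C) - monX (bwd C).
Proof.
move=> /andP[cC uC]; rewrite /cycle_binomial !monX_sum.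
congr (_ - _); rewrite !big_seq; apply: eq_bigr => t tC; apply: label_monX.
  exact: next_cycle.
by rewrite adj_sym; apply: next_cycle.
Qed.

Lemma edge_supported s t : adj s t -> supported (edge s t).
Proof.
move=> a x y i; rewrite /edge; case: eqP => // es; case: eqP => // et.
by rewrite es et /= i in a.
Qed.

Lemma edge_row s t x : adj s t -> (\sum_y edge s t x y = (s == inl x))%N.
Proof.
rewrite /edge; have [->|_] := eqVneq s (inl x); last by rewrite big1.
case: t => // y _; rewrite (bigD1 y) //= eqxx big1 // => y' /negPf n.
by case: eqP => // -[e]; rewrite e eqxx in n.
Qed.

Lemma edge_col s t y : adj s t -> (\sum_x edge s t x y = (t == inr y))%N.
Proof.
rewrite /edge; have [->|_] := eqVneq t (inr y); last first.
  by rewrite big1 // => x _; rewrite andbF.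
case: s => // x _; rewrite (bigD1 x) //= eqxx big1 // => x' /negPf n.
by rewrite andbT; case: eqP => // -[e]; rewrite e eqxx in n.
Qed.

Lemma cycle_balanced C : ucycle adj C ->
  [/\ supported (fwd C), supported (bwd C) & balanced (fwd C) (bwd C)].
Proof.
move=> /andP[cC uC].
have a1 t : t \in C -> adj t (next C t) by move=> tC; apply: next_cycle.
have a2 t : t \in C -> adj (next C t) t by rewrite adj_sym => /a1.
split.
- by move=> x y i; apply: big1_seq => t /andP[_ /a1/edge_supported]; apply.
- by move=> x y i; apply: big1_seq => t /andP[_ /a2/edge_supported]; apply.
split=> [x|y]; rewrite exchange_big [RHS]exchange_big /= big_seq [RHS]big_seq.
  rewrite (eq_bigr _ (fun t tC => edge_row x (a1 t tC))).
  rewrite (eq_bigr _ (fun t tC => edge_row x (a2 t tC))) -!big_seq.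
  by rewrite (prod_next _ (fun t => t == inl x : nat)).
rewrite (eq_bigr _ (fun t tC => edge_col y (a1 t tC))).
rewrite (eq_bigr _ (fun t tC => edge_col y (a2 t tC))) -!big_seq.
by rewrite (prod_next _ (fun t => t == inr y : nat)).
Qed.

Local Notation T := (graph_ideal k P).

Lemma graph_ideal_ideal : is_ideal T. Proof. exact: ideal_gen_ideal. Qed.

(* A chord splits a cycle into two shorter ones, whose binomials generate the
   binomial of the given cycle. *)
Lemma cycle_binomial_in C : (2 < size C)%N -> ucycle adj C -> T (cycle_binomial k C).
Proof.
have [n] := ubnP (size C); elim: n C => // n IHn C le_n C2 uC.
have [chordless|] := pselect ({in C &, forall x y : node, adj x y ->
    y = next C x \/ x = next C y}).
  by apply: sub_ideal_gen; exists C.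
move=> nch.
have [x [y [xC yC axy yx xy]]] : exists x y : node, [/\ x \in C, y \in C, adj x y,
    y <> next C x & x <> next C y].
  apply: contrapT => h; apply: nch => x y xC yC axy.
  apply: contrapT => h'; apply: h; exists x, y.
  by split=> // e; apply: h'; [left|right].
have [cC unC] := andP uC.
(* Rotate the cycle to start at the end [x] of the chord; splitting at [y] then gives the two cycles
   closed by the chord. *)
have [i s rC] := rot_to xC.
have rotE (l : node -> node -> ring) :
    \prod_(t <- C) l t (next C t) = \prod_(t <- rot i C) l t (next (rot i C) t).
  have p : perm_eq C (rot i C) by rewrite perm_sym perm_rot.
  by rewrite (perm_big _ p); apply: eq_bigr => t _; rewrite next_rot.
have cbE : cycle_binomial k C = cycle_binomial k (rot i C).
  by congr (_ - _); [exact: rotE | exact: rotE (fun s t => lab t s)].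
have ucrot : ucycle adj (x :: s) by rewrite -rC rot_ucycle.
have yx' : y <> next (x :: s) x by rewrite -rC next_rot.
have xy' : x <> next (x :: s) y by rewrite -rC next_rot.
have ys : y \in s.
  have : y \in x :: s by rewrite -rC mem_rot.
  rewrite inE => /predU1P[e|//]; move: axy; rewrite e.
  by case: (x).
have szC : size C = (size s).+1 by rewrite -(size_rot i) rC.
rewrite cbE rC; move: ucrot yx' xy' szC; case/splitPr: ys => s1 s2.
move=> /andP[]; rewrite [cycle _ _]/= rcons_cat rcons_cons => cyc un nx ny szC.
(* [x] and [y] are not consecutive on the cycle, so neither arc is empty and both new cycles have at
   least three nodes. *)
have s1n : s1 != [::].
  by apply: contra_not_neq nx => ->; rewrite /= eqxx.
have s2n : s2 != [::].
  apply: contra_not_neq ny => e.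
  subst s2; move: un; rewrite -cat_cons => un.
  by rewrite -(next_rot (size (x :: s1)) un) rot_size_cat /= eqxx.
have s1_0 : (0 < size s1)%N by rewrite lt0n size_eq0.
have s2_0 : (0 < size s2)%N by rewrite lt0n size_eq0.
move: (cyc); rewrite -cat_rcons cat_path last_rcons => /andP[p1 p2].
have u1 : uniq (x :: rcons s1 y).
  by move: un; rewrite -cat_rcons -cat_cons cat_uniq => /andP[].
have u2 : uniq (y :: rcons s2 x).
  rewrite -rcons_cons rcons_uniq; move: un; rewrite cons_uniq mem_cat negb_or.
  by rewrite cat_uniq => /andP[/andP[_ ->] /and3P[]].
have c1 : cycle adj (x :: rcons s1 y) by rewrite /= rcons_path p1 last_rcons adj_sym.
have c2 : cycle adj (y :: rcons s2 x) by rewrite /= rcons_path p2 last_rcons.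
move: szC le_n; rewrite size_cat /= => -> le_n.
have T1 : T (cycle_binomial k (x :: rcons s1 y)).
  apply: IHn; rewrite /ucycle ?c1 ?u1 //= size_rcons //.
  rewrite ltnS in le_n; apply: leq_trans le_n; rewrite addnS !ltnS.
  by rewrite -[X in (X < _)%N]addn0 ltn_add2l.
have T2 : T (cycle_binomial k (y :: rcons s2 x)).
  apply: IHn; rewrite /ucycle ?c2 ?u2 //= size_rcons //.
  rewrite ltnS in le_n; apply: leq_trans le_n; rewrite addnS !ltnS.
  by rewrite -[X in (X < _)%N]add0n ltn_add2r.
have [_ ID IM] := graph_ideal_ideal.
have bE z s' : uniq (z :: s') -> cycle_binomial k (z :: s') =
    path_prod lab z (rcons s' z) - path_prod (fun s t => lab t s) z (rcons s' z).
  by move=> us; rewrite /cycle_binomial !cycle_prodE // (cycle_prodE (fun s t => lab t s)).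
move: T1 T2; rewrite !bE // rcons_cat rcons_cons !path_prod_cat.
rewrite !(path_prod_rcons _ _ (rcons _ _)) !last_rcons.
set A := path_prod lab x _; set A' := path_prod _ x _.
set B := path_prod lab y _; set B' := path_prod _ y _.
(* The label of the chord occurs in one monomial of each short binomial, once forward and once
   backward, so it cancels in a combination equal to [A * B - A' * B']. *)
case: (x) (y) axy => [f|u] [f'|u'] //= _; rewrite ?mulr1.
  move=> T1 T2; rewrite (_ : _ - _ = B * (A - A' * slack_mx k f u') +
      A' * (B * slack_mx k f u' - B')); last by ring.
  by apply: ID; apply: IM.
move=> T1 T2; rewrite (_ : _ - _ = A * (B - B' * slack_mx k f' u) +
    B' * (A * slack_mx k f' u - A')); last by ring.
by apply: ID; apply: IM.
Qed.

End Monomials.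

(** * Binomials with equal degrees at all nodes *)

Lemma sum_nat_gt0P (I : finType) (f : I -> nat) :
  reflect (exists i, (0 < f i)%N) (0 < \sum_i f i)%N.
Proof.
apply: (iffP idP) => [|[i fi]]; last by rewrite (bigD1 i) //= addn_gt0 fi.
rewrite lt0n => nz; apply/existsP; apply: contra_neqT nz.
rewrite negb_exists => /forallP z; apply: big1 => i _.
by have := z i; rewrite lt0n negbK => /eqP.
Qed.

(** Pigeonhole on the first [#|T|.+1] iterates: of two equal ones, the earlier lies on a cycle of
    [f]. *)
Lemma iter_periodic (T : finType) (f : T -> T) (z : T) :
  exists i, fcycle f (orbit f (iter i f z)).
Proof.
have /injectivePn[i [j ij e]] : ~~ injectiveb (fun i : 'I_#|T|.+1 => iter i f z).
  by apply/negP => /injectiveP/leq_card; rewrite card_ord ltnn.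
wlog lt_ij : i j ij e / (i < j)%N.
  move=> wl; case: (ltngtP i j) => [||/val_inj eij]; first exact: wl.
    by apply: wl => //; rewrite eq_sym.
  by rewrite eij eqxx in ij.
exists i; apply/(orbitPcycle 0 3); exists (j - i).-1.
by rewrite prednK ?subn_gt0 // -iterD subnK // ltnW.
Qed.

Lemma sum_eq_count (T : eqType) (C : seq T) (z : T) :
  (\sum_(t <- C) (t == z) = count_mem z C)%N.
Proof. by rewrite -sum1_count [RHS]big_mkcond; apply: eq_bigr => t _ /=; case: eqP. Qed.

Section OhsugiHibi.
Variables (k : fieldType) (R : realFieldType) (d : nat) (P : polytope R d).
Local Notation Fc := (facet P).
Local Notation Vx := (vertex P).
Local Notation node := (Fc + Vx)%type.
Local Notation ring := (slack_ring k P).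
Local Notation adj := (@nonincidence_graph R d P).
Implicit Types (x : Fc) (y : Vx) (m : Fc -> Vx -> nat).

(** Leave facets along the support of [m] and vertices along that of [m']. Balance gives a way out
    of every node reached, so the walk falls into a cycle. *)
Lemma alternating_cycle m m' : supported m -> supported m' -> balanced m m' ->
    (forall x y, m x y = 0%N \/ m' x y = 0%N) ->
    (exists x y, 0 < m x y)%N ->
  exists C : seq node, [/\ (2 < size C)%N, ucycle adj C,
    forall x y, (fwd C x y <= m x y)%N & forall x y, (bwd C x y <= m' x y)%N].
Proof.
move=> sm sm' [rowE colE] dis [x0 [y0 m0]].
pose nxt (t : node) : node := match t with
  | inl x => if [pick y | (0 < m x y)%N] is Some y then inr y else t
  | inr y => if [pick x | (0 < m' x y)%N] is Some x then inl x else t end.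
pose good (t : node) := match t with
  | inl x => 0 < \sum_y m x y | inr y => 0 < \sum_x m x y end%N.
pose step (t t' : node) := match t, t' with
  | inl x, inr y => 0 < m x y | inr y, inl x => 0 < m' x y | _, _ => false end%N.
have nxtP t : good t -> good (nxt t) /\ step t (nxt t).
  case: t => [x|y] /=.
    move/sum_nat_gt0P=> [y my]; case: pickP => [y' my'|/(_ y)]; last by rewrite my.
    by split=> //; apply/sum_nat_gt0P; exists x.
  rewrite colE; move/sum_nat_gt0P=> [x mx].
  case: pickP => [x' mx'|/(_ x)]; last by rewrite mx.
  by split=> //=; rewrite rowE; apply/sum_nat_gt0P; exists y.
have goodi z i : good z -> good (iter i nxt z).
  by move=> gz; elim: i => //= i /nxtP[].
have [i cyc] := iter_periodic nxt (inl x0).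
move: cyc; set z := iter i nxt _ => cyc.
have gz : good z by apply: goodi; apply/sum_nat_gt0P; exists y0.
pose C := orbit nxt z.
have gC t : t \in C -> good t.
  by move=> /trajectP[j _ ->]; apply: goodi.
have nC t : t \in C -> next C t = nxt t.
  by move=> tC; apply/esym/eqP; apply: (next_cycle cyc tC).
have sC t : t \in C -> step t (nxt t) by move=> /gC/nxtP[].
have aC t : t \in C -> adj t (nxt t).
  move=> /sC; case: t (nxt t) => [x|y] [x'|y'] //=; apply: contraTN => inc.
    by rewrite sm.
  by rewrite sm'.
have uC : uniq C by apply: orbit_uniq.
have zC : z \in C by rewrite -fconnect_orbit connect0.
exists C; split.
(* Consecutive nodes differ in kind, and returning after two steps would use one edge in both [m]
   and [m'], so the period exceeds 2. *)
- have nn t : t \in C -> nxt t != t.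
    by move=> /aC; apply: contraTneq => e; rewrite e; case: (t).
  have nnn t : t \in C -> nxt (nxt t) != t.
    move=> tC; have nt : nxt t \in C by rewrite -nC ?mem_next.
    apply/eqP => e; move: (sC _ nt) (sC _ tC); rewrite e.
    case: (t) (nxt t) => [x|y] [x'|y'] //=.
      by have [->|->] := dis x y'.
    by have [->|->] := dis x' y.
  move: cyc (nn _ zC) (nnn _ zC); rewrite -/C.
  have [s CE] : exists s, C = z :: s.
    by rewrite /C /orbit; case: (order nxt z) (order_gt0 nxt z) => // o _; eexists.
  rewrite CE; case: s {CE} => [|t [|//]] /=.
    by rewrite andbT => /eqP ->; rewrite eqxx.
  by rewrite andbT => /andP[/eqP -> /eqP ->]; rewrite eqxx.
- rewrite /ucycle uC andbT; apply: cycle_from_next => // t tC.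
  by rewrite nC //; apply: aC.
(* [C] meets each facet at most once, so its forward exponents are at most 1, and they vanish where
   [m] does; likewise below for vertices and [m']. *)
- move=> x y; have [mxy|mxy] := posnP (m x y).
    rewrite mxy leqn0 /fwd big1_seq // => t /andP[_ tC].
    rewrite nC //; have := sC _ tC; rewrite /edge.
    case: eqP => // ->; case: eqP => //= ->.
    by rewrite mxy.
  apply: leq_trans mxy; apply: leq_trans (_ : \sum_(t <- C) (t == inl x) <= _)%N.
    by apply: leq_sum => t _; rewrite /edge; case: eqP => //= _; apply: leq_b1.
  by rewrite sum_eq_count (count_uniq_mem _ uC) leq_b1.
- move=> x y; have [mxy|mxy] := posnP (m' x y).
    rewrite mxy leqn0 /bwd big1_seq // => t /andP[_ tC].
    rewrite nC //; have := sC _ tC; rewrite /edge.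
    case: eqP => //= ->; case: eqP => //= ->.
    by rewrite /= mxy.
  apply: leq_trans mxy; apply: leq_trans (_ : \sum_(t <- C) (t == inr y) <= _)%N.
    by apply: leq_sum => t _; rewrite /edge andbC; case: eqP => //= _; apply: leq_b1.
  by rewrite sum_eq_count (count_uniq_mem _ uC) leq_b1.
Qed.

Local Notation T := (graph_ideal k P).

(** Induction on the degree of [m]: remove a variable common to both monomials, or, when the
    supports are disjoint, an alternating cycle. *)
Lemma balanced_binomial_in m m' : supported m -> supported m' -> balanced m m' ->
  T (monX k m - monX k m').
Proof.
have [I0 ID IM] := graph_ideal_ideal k P.
have [n] := ubnP (\sum_x \sum_y m x y)%N; elim: n m m' => // n IHn m m' le_n sm sm' bal.
pose sub m1 m2 x y := (m1 x y - m2 x y)%N.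
(* A part a of m and a balanced part a' of m', with binomial in T, can be
   removed, which lowers the degree. *)
have reduce (a a' : Fc -> Vx -> nat) :
    (forall x y, a x y <= m x y)%N -> (forall x y, a' x y <= m' x y)%N ->
    balanced a a' -> (exists x y, 0 < a x y)%N -> T (monX k a - monX k a') ->
  T (monX k m - monX k m').
  move=> am am' [ra ca] [x [y axy]] Ta; have [rm cm] := bal.
  have splitX m1 m2 : (forall x y, m1 x y <= m2 x y)%N ->
      monX k m2 = monX k m1 * monX k (sub m2 m1).
    by move=> le; rewrite -monXD; apply: eq_monX => u w; rewrite /sub subnKC.
  rewrite (splitX a m) // (splitX a' m') //.
  have -> : monX k a * monX k (sub m a) - monX k a' * monX k (sub m' a') =
      monX k (sub m a) * (monX k a - monX k a') +
      monX k a' * (monX k (sub m a) - monX k (sub m' a')) by ring.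
  apply: ID; first exact: IM.
  apply: IM; apply: IHn.
  - rewrite ltnS in le_n; apply: leq_trans le_n.
    have le1 u : (\sum_w sub m a u w <= \sum_w m u w)%N.
      by apply: leq_sum => w _; apply: leq_subr.
    rewrite (bigD1 x) //= [X in (_ < X)%N](bigD1 x) //= -addSn; apply: leq_add.
      rewrite (bigD1 y) //= [X in (_ < X)%N](bigD1 y) //= -addSn; apply: leq_add.
        by rewrite /sub -subSn ?am // leq_subLR -addn1 addnC leq_add2r.
      by apply: leq_sum => w _; apply: leq_subr.
    by apply: leq_sum => u _; apply: le1.
  - by move=> u w i; rewrite /sub sm.
  - by move=> u w i; rewrite /sub sm'.
  have sumB (I : finType) (f g : I -> nat) : (forall i, g i <= f i)%N ->
      (\sum_i (f i - g i) = \sum_i f i - \sum_i g i)%N.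
    by move=> le; rewrite sumnB.
  by split=> u; rewrite !sumB // ?rm ?ra ?cm ?ca.
have [[x [y [mx m'x]]]|dis] := pselect (exists x y, 0 < m x y /\ 0 < m' x y)%N.
  have le_delta m1 : (0 < m1 x y)%N -> forall u w, (delta x y u w <= m1 u w)%N.
    by move=> m1x u w; rewrite /delta; case: eqP => // <-; case: eqP => // <-.
  apply: (reduce (delta x y) (delta x y)); [exact: le_delta|exact: le_delta|by []| |].
    by exists x, y; rewrite /delta !eqxx.
  by rewrite subrr.
have [pos|nopos] := pselect (exists x y, 0 < m x y)%N.
  have dis' x y : m x y = 0%N \/ m' x y = 0%N.
    have [|mx] := posnP (m x y); first by left.
    have [|m'x] := posnP (m' x y); first by right.
    by case: dis; exists x, y.
  have [C [szC uC leF leB]] := alternating_cycle sm sm' bal dis' pos.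
  have [_ _ bC] := cycle_balanced uC.
  apply: (reduce (fwd C) (bwd C)) => //.
    have [cC unC] := andP uC.
    have [x xC] : exists x, inl x \in C.
      case: C szC uC {leF leB bC} cC unC => // -[x|y] [|t C] //= _ _.
        by move=> _ _; exists x; rewrite mem_head.
      case: t => [x|y'] //= _ _; exists x; by rewrite !inE eqxx orbT.
    have := next_cycle cC xC; case e: (next C (inl x)) => [//|y] _.
    exists x, y; rewrite /fwd (big_rem _ xC) /= /edge e !eqxx //.
  by rewrite -cycle_binomialE //; apply: cycle_binomial_in.
have m0 x y : m x y = 0%N.
  by apply/eqP; rewrite -leqn0 leqNgt; apply/negP => h; apply: nopos; exists x, y.
have m'0 x y : m' x y = 0%N.
  have [rm _] := bal; have := rm x; rewrite big1 => [/esym/eqP|? _]; last exact: m0.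
  by rewrite sum_nat_eq0 => /forallP/(_ y)/eqP.
have -> : monX k m = monX k m' by apply: eq_monX => x y; rewrite m0 m'0.
by rewrite subrr.
Qed.

End OhsugiHibi.

(** * The toric map and the 0/1 non-incidence matrix *)

Lemma expr_sum (A : comNzRingType) (I : finType) (z : A) (n : I -> nat) :
  z ^+ (\sum_i n i) = \prod_i z ^+ n i.
Proof. by apply: (big_morph (fun n => z ^+ n)) => // a b; rewrite exprD. Qed.

Section Toric.
Variables (k : fieldType) (R : realFieldType) (d : nat) (P : polytope R d).
Local Notation Fc := (facet P).
Local Notation Vx := (vertex P).
Local Notation node := (Fc + Vx)%type.
Local Notation ring := (slack_ring k P).
Local Notation pair := (nonincident_pair P).
Local Notation T := (graph_ideal k P).
Implicit Types (x : Fc) (y : Vx).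

Definition expo (m : 'X_{1..#|{: pair}|}) x y : nat :=
  if insub (x, y) is Some e then m (enum_rank (e : pair)) else 0%N.

Lemma expo_supported m : supported (expo m).
Proof. by move=> x y i; rewrite /expo insubF //= i. Qed.

Lemma mpolyX_expo m : 'X_[m] = monX k (expo m).
Proof.
rewrite mpolyXE_id /monX pair_bigA /= (bigID (fun p : Fc * Vx => ~~ incident p.1 p.2)).
rewrite /= [X in _ = _ * X]big1 ?mulr1 => [|[x y] /=]; last first.
  by rewrite negbK => i; rewrite expo_supported.
rewrite (reindex_omap (val : pair -> Fc * Vx) insub) /= => [|p np]; last first.
  by rewrite insubT.
rewrite (reindex (@enum_rank pair)) /=; last first.
  by exists enum_val => i _; rewrite ?enum_rankK ?enum_valK.
rewrite [RHS](eq_bigl xpredT) => [|e]; last by rewrite (valP e) valK eqxx.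
apply: eq_bigr => e _; rewrite /zvar /expo -surjective_pairing valK.
by [].
Qed.

Local Notation tring := {mpoly k[#|{: node}|]}.

Definition tvar (t : node) : tring := 'X_(enum_rank t).

Lemma tvar_neq0 t : tvar t != 0.
Proof.
by rewrite -msupp_eq0 /tvar msuppX.
Qed.

Definition theta : ring -> tring :=
  mmap (@mpolyC _ k) (fun i => let e := val (enum_val i : pair) in
    tvar (inl e.1) * tvar (inr e.2)).

HB.instance Definition _ := GRing.RMorphism.on theta.

Lemma thetaZ c f : theta (c *: f) = c *: theta f.
Proof. by rewrite /theta mmapZ mul_mpolyC. Qed.

Lemma theta_zvar x y : ~~ incident x y ->
  theta (zvar k x y) = tvar (inl x) * tvar (inr y).
Proof.
move=> n; rewrite /zvar insubT /theta mmapX mmap1U enum_rankK.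
by [].
Qed.

Definition tdeg (m : Fc -> Vx -> nat) : 'X_{1..#|{: node}|} :=
  [multinom (match enum_val j with
    | inl x => \sum_y m x y | inr y => \sum_x m x y end)%N | j < #|{: node}|].

Lemma theta_monX m : supported m -> theta (monX k m) = 'X_[tdeg m].
Proof.
move=> sm; rewrite rmorph_prod /=.
transitivity (\prod_x \prod_y (tvar (inl x) ^+ m x y * tvar (inr y) ^+ m x y)).
  apply: eq_bigr => x _; rewrite rmorph_prod; apply: eq_bigr => y _ /=.
  rewrite rmorphXn /= -exprMn; have [i|n] := boolP (incident x y).
    by rewrite sm.
  by rewrite theta_zvar.
under eq_bigr do rewrite big_split /=.
rewrite big_split /= [X in _ * X]exchange_big /= mpolyXE_id.
rewrite (reindex (@enum_rank node)) /=; last first.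
  by exists enum_val => i _; rewrite ?enum_rankK ?enum_valK.
rewrite big_sumType /=; congr (_ * _); apply: eq_bigr => u _;
  by rewrite mnmE enum_rankK expr_sum.
Qed.

Lemma tdeg_balanced m m' : tdeg m = tdeg m' -> balanced m m'.
Proof.
move=> /mnmP e; split=> u.
  by have := e (enum_rank (inl u : node)); rewrite !mnmE enum_rankK.
by have := e (enum_rank (inr u : node)); rewrite !mnmE enum_rankK.
Qed.

(** In [theta f] the image of a monomial [m] of [f] must be cancelled by another monomial [m'] with
    the same image. The difference of the two is a balanced binomial, and subtracting a multiple of
    it removes [m] without adding a new monomial. *)
Lemma theta_kernel f : theta f = 0 -> T f.
Proof.
have [I0 ID IM] := graph_ideal_ideal k P.
have [n] := ubnP (size (msupp f)); elim: n f => // n IHn f le_n f0.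
case e: (msupp f) => [|m s].
  by have /eqP := e; rewrite msupp_eq0 => /eqP ->.
have mf : m \in msupp f by rewrite e mem_head.
have fE : theta f = \sum_(m <- msupp f) f@_m *: 'X_[tdeg (expo m)].
  rewrite {1}(mpolyE f) raddf_sum; apply: eq_bigr => u _ /=.
  rewrite thetaZ; congr (_ *: _).
  by rewrite mpolyX_expo theta_monX //; apply: expo_supported.
have [[m' [m'f m'm dm']]|nm] := pselect (exists m', [/\ m' \in msupp f, m' != m &
    tdeg (expo m') = tdeg (expo m)]).
  pose g : ring := 'X_[m] - 'X_[m'].
  have Tg : T g.
    rewrite /g !mpolyX_expo; apply: balanced_binomial_in; try exact: expo_supported.
    exact/tdeg_balanced/esym.
  rewrite -[f](subrK (f@_m *: g)); apply: (ID); last by rewrite -mul_mpolyC; apply: IM.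
  have g0 : theta g = 0.
    rewrite rmorphB /= !mpolyX_expo !theta_monX ?dm' ?subrr //;
    exact: expo_supported.
  apply: IHn; last first.
    by rewrite rmorphB /= f0 thetaZ g0 scaler0 subrr.
  rewrite ltnS in le_n; apply: leq_trans le_n.
  apply: leq_ltn_trans (_ : size (rem m (msupp f)) < _)%N; last first.
    by rewrite size_rem // ltn_predL e.
  apply: uniq_leq_size => [|u]; first exact: msupp_uniq.
  rewrite mem_rem_uniq ?msupp_uniq // !inE !mcoeff_msupp.
  rewrite mcoeffB mcoeffZ mcoeffB !mcoeffX.
  have [->|um] := eqVneq u m.
    by rewrite ?eqxx (negPf m'm) subr0 mulr1 subrr eqxx.
  rewrite ?[m == u]eq_sym ?(negPf um) /=; have [<-|um'] := eqVneq m' u.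
    by rewrite -mcoeff_msupp.
  by rewrite ?subr0 ?mulr0 subr0.
have := congr1 (mcoeff (tdeg (expo m))) fE; rewrite f0 mcoeff0 raddf_sum /=.
rewrite (bigD1_seq m) ?msupp_uniq //= mcoeffZ mcoeffX eqxx mulr1 big_seq_cond big1.
  by rewrite addr0 => /esym/eqP; rewrite mcoeff_eq0 mf.
move=> u /andP[uf um]; rewrite mcoeffZ mcoeffX; case: eqP; rewrite ?mulr0 // => eu.
by case: nm; exists u.
Qed.

Definition nonincidence n (r : 'I_n -> Fc) (c : 'I_n -> Vx) : 'M[k]_n :=
  \matrix_(i, j) (~~ incident (r i) (c j))%:R.

Lemma theta_minor n (r : 'I_n -> Fc) (c : 'I_n -> Vx) :
  \det (nonincidence r c) = 0 ->
  theta (\det (\matrix_(i, j) slack_mx k (r i) (c j))) = 0.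
Proof.
move=> det0; rewrite -det_map_mx.
have -> : map_mx theta (\matrix_(i, j) slack_mx k (r i) (c j)) =
    diag_mx (\row_i tvar (inl (r i))) *m
    map_mx (@mpolyC _ k) (nonincidence r c) *m diag_mx (\row_j tvar (inr (c j))).
  apply/matrixP => i j; rewrite mul_mx_diag mul_diag_mx !mxE slack_mxE.
  have [inc|inc] := boolP (incident _ _).
    by rewrite rmorph0 /= mpolyC0 mulr0 mul0r.
  by rewrite theta_zvar // mpolyC1 mulr1.
by rewrite !det_mulmx det_map_mx det0 /= mpolyC0 mulr0 mul0r.
Qed.

(** [theta] kills the minors, and saturation is harmless because every variable goes to a nonzero
    element of a domain. *)
Lemma slack_sub_graph :
    (forall (r : 'I_(pdim P).+2 -> Fc) c, \det (nonincidence r c) = 0) ->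
  forall f, slack_ideal k P f -> T f.
Proof.
move=> det0 f [n nf]; apply: theta_kernel.
have : theta ((\prod_i 'X_i) ^+ n * f) = 0.
  apply: (ideal_gen_min (I := fun g => theta g = 0)) nf.
    split=> [|g h g0 h0|g h h0]; rewrite ?rmorph0 //.
      by rewrite rmorphD /= g0 h0 addr0.
    by rewrite rmorphM /= h0 mulr0.
  by move=> _ [r [c [_ _ ->]]]; apply: theta_minor.
rewrite rmorphM rmorphXn rmorph_prod /= => /eqP; rewrite mulf_eq0 expf_eq0.
case/orP=> [/andP[_]|/eqP //]; rewrite prodf_seq_eq0 => /hasP[i _ /=].
by rewrite /theta mmapX mmap1U mulf_eq0 !(negPf (tvar_neq0 _)).
Qed.

Lemma graph_ideal_ones f : T f -> f.@[fun=> 1] = 0.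
Proof.
apply: (ideal_gen_min (I := fun g => g.@[fun=> 1] = 0)).
  split=> [|g h g0 h0|g h h0]; rewrite ?meval0 //.
    by rewrite mevalD g0 h0 addr0.
  by rewrite mevalM h0 mulr0.
have one m : (monX k (P := P) m).@[fun=> 1] = 1.
  rewrite rmorph_prod big1 //= => x _; rewrite rmorph_prod big1 //= => y _.
  rewrite rmorphXn /= /zvar; case: insubP => [e _ _|_]; rewrite ?mevalXU ?meval1 expr1n //.
by move=> _ [C [_ uC _] ->]; rewrite cycle_binomialE // mevalB !one subrr.
Qed.

(** The slack minors lie in [T], which vanishes at the all-ones point by [graph_ideal_ones]; there
    the slack matrix becomes the 0/1 matrix. Choices with a repeated row or column have zero
    determinant anyway. *)
Lemma graphic_nonincidence : (forall f, slack_ideal k P f -> T f) ->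
  forall (r : 'I_(pdim P).+2 -> Fc) c, \det (nonincidence r c) = 0.
Proof.
move=> sub r c.
have [ij|/injectivePn[i [j ij e]]] := boolP (injectiveb r); last first.
  by apply: (determinant_alternate ij) => l; rewrite !mxE e.
have [ijc|/injectivePn[i [j ij' e]]] := boolP (injectiveb c); last first.
  rewrite -det_tr; apply: (determinant_alternate ij') => l.
  by rewrite !mxE e.
have : slack_ideal k P (\det (\matrix_(i, j) slack_mx k (r i) (c j))).
  apply: sub_saturation; apply: sub_ideal_gen; exists r, c.
  by split=> //; apply/injectiveP.
move/sub/graph_ideal_ones; rewrite -det_map_mx => <-.
congr (\det _); apply/matrixP => u w; rewrite !mxE slack_mxE.
case: (boolP (incident _ _)) => inc /=; first by rewrite meval0.
by rewrite /zvar insubT /= mevalXU.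
Qed.

End Toric.
(** * Ranks and minors *)

Section RankMinors.
Variable k : fieldType.

Lemma minor0_up m n (A : 'M[k]_(m, n)) s t : (s <= t)%N ->
    (forall (f : 'I_s -> 'I_m) g, \det (mxsub f g A) = 0) ->
  forall (f : 'I_t -> 'I_m) g, \det (mxsub f g A) = 0.
Proof.
move=> /subnKC <-; elim: (t - s)%N => [|p IHp] h f g.
  by move: f g; rewrite addn0.
move: f g; rewrite addnS => f g; rewrite (expand_det_row _ ord0) big1 // => j _.
rewrite /cofactor; set B := row' _ _.
have -> : B = mxsub (f \o lift ord0) (g \o lift j) A.
  by apply/matrixP => u v; rewrite !mxE.
by rewrite IHp // !mulr0.
Qed.

Lemma rank_lt_minors m n (A : 'M[k]_(m, n)) s :
    (forall (f : 'I_s -> 'I_m) g, \det (mxsub f g A) = 0) -> (\rank A < s)%N.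
Proof.
move=> h; rewrite ltnNge; apply/negP => le_s.
have full : row_full (rowsub (maxrankfun A) A)^T.
  by rewrite /row_full mxrank_tr; apply: maxrowsub_free.
have := fullrowsub_unit full; rewrite unitmxE unitfE => /negP; apply.
rewrite -det_tr; apply/eqP; set B := (_^T)%R.
have -> : B = mxsub (maxrankfun A) (fullrankfun full) A.
  by apply/matrixP => u v; rewrite !mxE.
exact: minor0_up le_s h _ _.
Qed.

Lemma minor0_rank_lt m n (A : 'M[k]_(m, n)) s (f : 'I_s -> 'I_m) (g : 'I_s -> 'I_n) :
  (\rank A < s)%N -> \det (mxsub f g A) = 0.
Proof.
move=> lt_s; apply: contraTeq lt_s => nz; rewrite -leqNgt.
have /mxrank_unit <- : mxsub f g A \in unitmx by rewrite unitmxE unitfE.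
have -> : mxsub f g A = rowsub f 1%:M *m (A *m colsub g 1%:M).
  rewrite mulmx_colsub mulmx1 mul_rowsub_mx mul1mx.
  by apply/matrixP => u v; rewrite !mxE.
exact: leq_trans (mxrankM_maxr _ _) (mxrankM_maxl _ _).
Qed.

End RankMinors.
(** * The slack ideal of a vertex sum *)

Section SlackIdeal.
Variables (k : fieldType) (R : realFieldType) (d : nat) (W : polytope R d).
Local Notation Fc := (facet W).
Local Notation Vx := (vertex W).
Local Notation ring := (slack_ring k W).
Local Notation I := (slack_ideal k W).
Implicit Types (H : Fc) (z : Vx).

Local Notation minor r c := (\det (\matrix_(i, j) slack_mx k (r i) (c j))).

Lemma slack_ideal_ideal : is_ideal I.
Proof. exact/saturation_ideal/ideal_gen_ideal. Qed.

Lemma slack_ideal_zvar H z f : I (zvar k H z * f) -> I f.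
Proof.
move=> h; apply: (saturation_cancel (n := 1) _ h); first exact: ideal_gen_ideal.
rewrite /zvar; case: insubP => [e _ _|_]; last by exists (\prod_i 'X_i); rewrite mulr1.
by rewrite (bigD1 (enum_rank e)) //= mulrC; eexists.
Qed.

Lemma slack_ideal_prod (J : finType) (F : J -> ring) f :
  (forall j g, I (F j * g) -> I g) -> I (\prod_j F j * f) -> I f.
Proof.
move=> hF; elim/big_rec: _ f => [|j p _ IHp] f; first by rewrite mul1r.
by rewrite -mulrA => /hF/IHp.
Qed.

Lemma slack_ideal_exp (p : ring) n f :
  (forall g, I (p * g) -> I g) -> I (p ^+ n * f) -> I f.
Proof.
move=> hp; elim: n f => [|n IHn] f; first by rewrite expr0 mul1r.
by rewrite exprS -mulrA => /hp/IHn.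
Qed.

Lemma slack_ideal_monX m f : I (monX k m * f) -> I f.
Proof.
apply: slack_ideal_prod => H g; apply: slack_ideal_prod => z {}g.
by apply: slack_ideal_exp => {}g; apply: slack_ideal_zvar.
Qed.

Lemma slack_ideal_minor n (r : 'I_n -> Fc) c : n = (pdim W).+2 -> I (minor r c).
Proof.
move=> en; subst n.
have [I0 _ _] := slack_ideal_ideal.
have [ij|/injectivePn[i [j ij e]]] := boolP (injectiveb r); last first.
  by rewrite (determinant_alternate ij) // => l; rewrite !mxE e.
have [ijc|/injectivePn[i [j ij' e]]] := boolP (injectiveb c); last first.
  by rewrite -det_tr (determinant_alternate ij') // => l; rewrite !mxE e.
by apply/sub_saturation/sub_ideal_gen; exists r, c; split=> //; apply/injectiveP.
Qed.

Definition fcons T n (h : T) (r : 'I_n -> T) (i : 'I_n.+1) : T :=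
  if unlift ord0 i is Some i' then r i' else h.

Lemma fcons0 T n (h : T) (r : 'I_n -> T) : fcons h r ord0 = h.
Proof. by rewrite /fcons unlift_none. Qed.

Lemma fconsS T n (h : T) (r : 'I_n -> T) i : fcons h r (lift ord0 i) = r i.
Proof. by rewrite /fcons liftK. Qed.

Lemma minor_fcons_row n (r : 'I_n -> Fc) c H z :
    ~~ incident H z -> (forall j, incident H (c j)) ->
  minor (fcons H r) (fcons z c) = zvar k H z * minor r c.
Proof.
move=> nHz Hc; rewrite (expand_det_row _ ord0) big_ord_recl big1 ?addr0 => [|j _].
  rewrite mxE !fcons0 slack_mxE (negPf nHz) /cofactor addn0 expr0 mul1r.
  by congr (_ * \det _); apply/matrixP => i j; rewrite !mxE !fconsS.
by rewrite mxE fcons0 fconsS slack_mxE Hc mul0r.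
Qed.

Lemma minor_fcons_col n (r : 'I_n -> Fc) c H z :
    ~~ incident H z -> (forall i, incident (r i) z) ->
  minor (fcons H r) (fcons z c) = zvar k H z * minor r c.
Proof.
move=> nHz Hc; rewrite (expand_det_col _ ord0) big_ord_recl big1 ?addr0 => [|j _].
  rewrite mxE !fcons0 slack_mxE (negPf nHz) /cofactor addn0 expr0 mul1r.
  by congr (_ * \det _); apply/matrixP => i j; rewrite !mxE !fconsS.
by rewrite mxE fcons0 fconsS slack_mxE Hc mul0r.
Qed.

(** Each pair of [s] adds a row vanishing on the earlier columns; expanding along it gives the old
    minor times a variable, which saturation cancels. *)
Lemma extend_rows (s : seq (Fc * Vx)) N n (r : 'I_n -> Fc) (c : 'I_n -> Vx) :
    (n + size s)%N = N ->
    (forall e, e \in s -> ~~ incident e.1 e.2) ->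
    pairwise (fun e1 e2 : Fc * Vx => incident e2.1 e1.2) s ->
    (forall e j, e \in s -> incident e.1 (c j)) ->
    (forall (r' : 'I_N -> Fc) c', (forall j, c' j \in codom c ++ map snd s) ->
       I (minor r' c')) ->
  I (minor r c).
Proof.
elim: s n r c => [|[H z] s IHs] n r c; rewrite ?addn0 => eN nd pw Hc hI.
  move: hI; rewrite -eN => hI; apply: hI => j.
  by rewrite cats0 codom_f.
apply: (@slack_ideal_zvar H z); rewrite -minor_fcons_row; last 2 first.
- by apply: (nd (H, z)); rewrite mem_head.
- by move=> j; apply: (Hc (H, z)); rewrite mem_head.
move: pw => /= /andP[/allP pz pw]; apply: IHs => //.
- by rewrite -eN /= addnS.
- by move=> e es; apply: nd; rewrite inE es orbT.
- move=> e j es; case: (unliftP ord0 j) => [j'|] ->.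
    by rewrite fconsS; apply: Hc; rewrite inE es orbT.
  by rewrite fcons0; apply: (pz e).
move=> r' c' hc'; apply: hI => j; have := hc' j; rewrite !mem_cat /=.
case/orP => [/codomP[i ->]|h]; last by rewrite inE h !orbT.
case: (unliftP ord0 i) => [i'|] ->; first by rewrite fconsS codom_f.
by rewrite fcons0 mem_head orbT.
Qed.

(** Here the new columns vanish on the earlier rows, whence the opposite order in [pairwise]. The
    origin of the columns of [c'] tells [two_minor] that they are vertices of [P]. *)
Lemma extend_cols (s : seq (Fc * Vx)) N n (r : 'I_n -> Fc) (c : 'I_n -> Vx) :
    (n + size s)%N = N ->
    (forall e, e \in s -> ~~ incident e.1 e.2) ->
    pairwise (fun e1 e2 : Fc * Vx => incident e1.1 e2.2) s ->
    (forall e i, e \in s -> incident (r i) e.2) ->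
    (forall (r' : 'I_N -> Fc) c', (forall j, c' j \in codom c ++ map snd s) ->
       I (minor r' c')) ->
  I (minor r c).
Proof.
elim: s n r c => [|[H z] s IHs] n r c; rewrite ?addn0 => eN nd pw Hc hI.
  move: hI; rewrite -eN => hI; apply: hI => j.
  by rewrite cats0 codom_f.
apply: (@slack_ideal_zvar H z); rewrite -minor_fcons_col; last 2 first.
- by apply: (nd (H, z)); rewrite mem_head.
- by move=> j; apply: (Hc (H, z)); rewrite mem_head.
move: pw => /= /andP[/allP pz pw]; apply: IHs => //.
- by rewrite -eN /= addnS.
- by move=> e es; apply: nd; rewrite inE es orbT.
- move=> e j es; case: (unliftP ord0 j) => [j'|] ->.
    by rewrite fconsS; apply: Hc; rewrite inE es orbT.
  by rewrite fcons0; apply: (pz e).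
move=> r' c' hc'; apply: hI => j; have := hc' j; rewrite !mem_cat /=.
case/orP => [/codomP[i ->]|h]; last by rewrite inE h !orbT.
case: (unliftP ord0 i) => [i'|] ->; first by rewrite fconsS codom_f.
by rewrite fcons0 mem_head orbT.
Qed.

(** The lattice of the binomials in [I]. One pair of exponents representing [u] is enough: by
    [lat_binomial] all others follow. *)
Definition lat (u : {ffun Fc * Vx -> int}) : Prop :=
  exists m m' : Fc -> Vx -> nat,
    (forall H z, u (H, z) = (m H z)%:Z - (m' H z)%:Z) /\ I (monX k m - monX k m').

Lemma lat0 : lat 0.
Proof.
exists (fun _ _ => 0%N), (fun _ _ => 0%N); split=> [H z|]; rewrite ?ffunE ?subrr //.
by have [] := slack_ideal_ideal.
Qed.

Lemma latN u : lat u -> lat (- u).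
Proof.
move=> [m [m' [um Im]]]; exists m', m; split=> [H z|].
  by rewrite ffunE um opprB.
by rewrite -opprB; apply: idealN slack_ideal_ideal _.
Qed.

Lemma latD u w : lat u -> lat w -> lat (u + w).
Proof.
have [I0 ID IM] := slack_ideal_ideal.
move=> [m [m' [um Im]]] [n [n' [wn In]]].
exists (fun H z => m H z + n H z)%N, (fun H z => m' H z + n' H z)%N; split=> [H z|].
  by rewrite ffunE um wn !PoszD opprD addrACA.
rewrite !monXD (_ : _ - _ = monX k n * (monX k m - monX k m') +
  monX k m' * (monX k n - monX k n')); last by ring.
by apply: ID; apply: IM.
Qed.

Lemma lat_square (f1 f2 f3 f4 : {ffun Fc * Vx -> int}) (m1 m2 m3 m4 : Fc -> Vx -> nat) :
    (forall H z, f1 (H, z) = (m1 H z)%:Z) -> (forall H z, f2 (H, z) = (m2 H z)%:Z) ->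
    (forall H z, f3 (H, z) = (m3 H z)%:Z) -> (forall H z, f4 (H, z) = (m4 H z)%:Z) ->
    I (monX k m1 * monX k m4 - monX k m2 * monX k m3) ->
  lat (f1 - f2 - (f3 - f4)).
Proof.
move=> e1 e2 e3 e4 Im.
exists (fun H z => m1 H z + m4 H z)%N, (fun H z => m2 H z + m3 H z)%N.
split=> [H z|]; last by rewrite !monXD.
by rewrite !ffunE e1 e2 e3 e4 !PoszD; ring.
Qed.

Lemma lat_sum (J : Type) (s : seq J) (p : pred J) (F : J -> {ffun Fc * Vx -> int}) :
  (forall j, p j -> lat (F j)) -> lat (\sum_(j <- s | p j) F j).
Proof. by move=> h; apply: big_ind => //; [exact: lat0 | exact: latD]. Qed.

Lemma lat_mulz u (n : int) : lat u -> lat (u *~ n).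
Proof.
move=> lu; have nat n' : lat (u *+ n').
  by elim: n' => [|n' IH]; rewrite ?mulr0n ?mulrS; [exact: lat0 | exact: latD].
by case: n => n; rewrite ?NegzE ?mulrNz -pmulrn //; apply: latN.
Qed.

(** Both pairs of exponents have the same difference, so multiplying by the monomial of [n'] yields
    a multiple of the known binomial; saturation then cancels that monomial. *)
Lemma lat_binomial u m m' : lat u ->
  (forall H z, u (H, z) = (m H z)%:Z - (m' H z)%:Z) -> I (monX k m - monX k m').
Proof.
have [I0 ID IM] := slack_ideal_ideal.
move=> [n [n' [un In]]] um; apply: (@slack_ideal_monX n').
have e : monX k m * monX k n' = monX k n * monX k m'.
  rewrite -!monXD; apply: eq_monX => H z; apply/eqP.
  rewrite -eqz_nat !PoszD -subr_eq0.
  have := um H z; rewrite un => h.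
  rewrite (_ : _ - _ = ((m H z)%:Z - (m' H z)%:Z) - ((n H z)%:Z - (n' H z)%:Z));
    last by ring.
  by rewrite -h subrr.
rewrite (_ : _ * _ = monX k m' * (monX k n - monX k n')); first exact: IM.
by rewrite !mulrBr [monX k n' * _]mulrC e; ring.
Qed.

End SlackIdeal.

(** * The lattice of binomials of a vertex sum *)

Lemma pairwise_rev (T : Type) (r : rel T) (s : seq T) :
  pairwise r (rev s) = pairwise (fun x y => r y x) s.
Proof.
elim: s => //= x s IHs; rewrite rev_cons pairwise_rcons all_rev IHs.
by congr (_ && _).
Qed.

Lemma det_mx2 (A : comNzRingType) (M : 'M[A]_2) :
  \det M = M 0 0 * M 1 1 - M 0 1 * M 1 0.
Proof.
rewrite (expand_det_row _ 0) !big_ord_recl big_ord0 addr0 /cofactor !det_mx11.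
rewrite !mxE /= expr0 expr1 mul1r mulN1r mulrN.
by congr (M _ _ * M _ _ - M _ _ * M _ _); apply: val_inj.
Qed.

Lemma Posz_sum (J : Type) (r : seq J) (p : pred J) (f : J -> nat) :
  (\sum_(j <- r | p j) f j)%N = \sum_(j <- r | p j) (f j)%:Z :> int.
Proof. exact: (big_morph Posz PoszD). Qed.

Lemma mulrz_sum_const (V : zmodType) (J : finType) (p : pred J) (e : V)
    (f : J -> V) (n : J -> int) :
  (forall j, p j -> f j = e) -> e *~ (\sum_(j | p j) n j) = \sum_(j | p j) f j *~ n j.
Proof. by move=> fe; rewrite mulrz_sumr; apply: eq_bigr => j /fe ->. Qed.

Lemma ffunMzE (T : finType) (V : zmodType) (f : {ffun T -> V}) (n : int) t :
  (f *~ n) t = f t *~ n.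
Proof.
have natE m : (f *+ m) t = f t *+ m by rewrite ffunMnE.
by case: n => n; rewrite ?NegzE ?mulrNz -?pmulrn ?ffunE natE.
Qed.

Section GluedLattice.
Variables (k : fieldType) (R : realFieldType) (a b c : nat).
Variables (P : polytope R a) (v : vertex P) (Q : polytope R b) (w : vertex Q).
Variables (W : polytope R c).
Variables (iP : vertex P -> vertex W) (iQ : vertex Q -> vertex W).
Hypothesis gl : glued v w iP iQ.
Variables (liftP : facet P -> facet W) (liftQ : facet Q -> facet W).
Hypothesis liftPE : forall F : facet P, iP @^-1: val (liftP F) = val F.
Hypothesis liftPT : forall F : facet P,
  v \in val F -> iQ @^-1: val (liftP F) = [set: vertex Q].
Hypothesis liftQE : forall G : facet Q, iQ @^-1: val (liftQ G) = val G.
Hypothesis liftQT : forall G : facet Q,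
  w \in val G -> iP @^-1: val (liftQ G) = [set: vertex P].

Local Notation I := (slack_ideal k W).
Local Notation minor r c := (\det (\matrix_(i, j) slack_mx k (r i) (c j))).

Lemma sum_glued (V : zmodType) (f : vertex W -> V) :
  \sum_z f z = f (iP v) + \sum_(x | x != v) f (iP x) + \sum_(y | y != w) f (iQ y).
Proof.
have [injP injQ g cov _] := gl.
rewrite (bigD1 (iP v)) //= -addrA; congr (_ + _).
rewrite (bigID (fun z => z \in iP @: [set~ v])) /=; congr (_ + _).
  rewrite (eq_bigl (mem (iP @: [set~ v]))) => [|z /=]; last first.
    rewrite andb_idl // => /imsetP[x]; rewrite !inE => xv ->.
    by rewrite (inj_eq injP).
  by rewrite big_imset /= => [|x x' _ _ /injP//]; apply: eq_bigl => x; rewrite !inE.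
rewrite (eq_bigl (mem (iQ @: [set~ w]))) => [|z /=].
  by rewrite big_imset /= => [|x x' _ _ /injQ//]; apply: eq_bigl => x; rewrite !inE.
have [[x ->]|[y ->]] := cov z.
  rewrite mem_imset // !inE negbK (inj_eq injP) andNb; apply/esym/negbTE/negP.
  by move=> /imsetP[y]; rewrite !inE => yw /g[_ e]; rewrite e eqxx in yw.
rewrite [RHS]mem_imset // !inE (glued_pt gl) (inj_eq injQ) andb_idr // => yw.
apply/negP => /imsetP[x]; rewrite !inE => xv /esym/g[e _].
by rewrite e eqxx in xv.
Qed.

Lemma incident_liftP F x : incident (liftP F) (iP x) = incident F x.
Proof. by rewrite /incident -liftPE [RHS]inE. Qed.

Lemma incident_liftQ G y : incident (liftQ G) (iQ y) = incident G y.
Proof. by rewrite /incident -liftQE [RHS]inE. Qed.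

(* Border the minor with the rows and columns of a flag of Q from w to Q: these
   rows vanish at the vertices of P. *)
Lemma minor_P (r : 'I_(pdim P).+2 -> facet W) (x : 'I_(pdim P).+2 -> vertex P) :
  I (minor r (fun j => iP (x j))).
Proof.
have [|s [sz sP pw]] := flag (is_face1 w) (is_faceT Q); first exact: subsetT.
pose s' := [seq (liftQ e.1, iQ e.2) | e <- s].
apply: (@extend_rows k _ _ W s' (pdim W).+2).
- rewrite size_map sz arankT arank1 subSS subn0 (pdim_glued gl).
  by rewrite !addSn.
- by move=> _ /mapP[e /sP[_ _ e2] ->]; rewrite incident_liftQ.
- rewrite pairwise_map; apply: sub_pairwise pw => e1 e2 /=.
  by rewrite incident_liftQ.
- move=> _ j /mapP[e /sP[e1 _ _] ->] /=; rewrite sub1set in e1.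
  by have := liftQT e1 => /setP/(_ (x j)); rewrite !inE.
- by move=> r' c' _; apply: slack_ideal_minor.
Qed.

(** Bordered by a flag of [P] from the empty face to [F], the 2x2 minor reaches size [(pdim P).+2]
    with all columns in [P], so [minor_P] applies. The new vertices lie in [F], hence in both [H1]
    and [H2]. *)
Lemma two_minor (F : facet P) (H1 H2 : facet W) (x1 x2 : vertex P) :
    iP @^-1: val H1 = val F -> iP @^-1: val H2 = val F ->
    ~~ incident F x1 -> ~~ incident F x2 ->
  I (zvar k H1 (iP x1) * zvar k H2 (iP x2) - zvar k H1 (iP x2) * zvar k H2 (iP x1)).
Proof.
move=> e1 e2 n1 n2.
have i1 x : incident H1 (iP x) = incident F x by rewrite /incident -e1 [RHS]inE.
have i2 x : incident H2 (iP x) = incident F x by rewrite /incident -e2 [RHS]inE.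
pose r (i : 'I_2) := if i == 0 then H1 else H2.
pose q (i : 'I_2) := iP (if i == 0 then x1 else x2).
suff : I (minor r q).
  by rewrite det_mx2 !mxE !slack_mxE /r /q /= !i1 !i2 (negPf n1) (negPf n2).
have [|s [sz sP pw]] := flag (is_face0 P) (proj1 (facetP F)); first exact: sub0set.
(* [extend_cols] wants the order opposite to that of [flag]. *)
pose s' := [seq (liftP e.1, iP e.2) | e <- rev s].
have s'P y : y \in map snd s' -> exists x, y = iP x.
  by move=> /mapP[_ /mapP[e _ ->] ->]; exists e.2.
apply: (@extend_cols k _ _ W s' (pdim P).+2).
- rewrite size_map size_rev sz arank0 subn0; have := proj2 (facetP F).
  by rewrite arankT => -[->].
- move=> e0 /mapP[e]; rewrite mem_rev => /sP[_ _ n] ->.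
  by rewrite incident_liftP.
- rewrite pairwise_map pairwise_rev; apply: sub_pairwise pw => e e' /=.
  by rewrite incident_liftP.
- move=> e0 i /mapP[e]; rewrite mem_rev => /sP[_ eF _] -> /=.
  by rewrite /r; case: eqP; rewrite ?i1 ?i2.
move=> r' c' hc'.
have hx j : exists x, c' j = iP x.
  have := hc' j; rewrite mem_cat => /orP[/codomP[i ->]|/s'P//].
  by rewrite /q; case: eqP; eexists.
have [x xE] := choice hx.
have -> : c' = fun j => iP (x j) by apply: funext.
exact: minor_P.
Qed.

Definition pull : slack_ring k P -> slack_ring k W :=
  mmap (@mpolyC _ k) (fun i => let e := val (enum_val i : nonincident_pair P) in
    zvar k (liftP e.1) (iP e.2)).

HB.instance Definition _ := GRing.RMorphism.on pull.

Lemma pull_zvar F x : ~~ incident F x -> pull (zvar k F x) = zvar k (liftP F) (iP x).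
Proof. by move=> n; rewrite /zvar insubT /pull mmapX mmap1U enum_rankK. Qed.

Lemma pull_slack F x : pull (slack_mx k F x) = slack_mx k (liftP F) (iP x).
Proof.
rewrite !slack_mxE incident_liftP; case: ifPn => [_|n]; first exact: rmorph0.
exact: pull_zvar.
Qed.

(** [pull] sends slack minors of [P] to minors of [W] with columns in [P], and variables to
    variables, so the saturating factor can be cancelled in [I]. *)
Lemma pull_ideal f : slack_ideal k P f -> I (pull f).
Proof.
have [I0 ID IM] := slack_ideal_ideal k W.
move=> [n nf]; have : I (pull ((\prod_i 'X_i) ^+ n * f)).
  apply: (ideal_gen_min (I := fun g => I (pull g))) nf.
    split=> [|g h g0 h0|g h h0]; rewrite ?rmorph0 ?rmorphD ?rmorphM //.
      exact: ID.
    exact: IM.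
  move=> _ [r [x [_ _ ->]]]; rewrite -det_map_mx.
  have -> : map_mx pull (\matrix_(i, j) slack_mx k (r i) (x j)) =
      \matrix_(i, j) slack_mx k (liftP (r i)) (iP (x j)).
    by apply/matrixP => i j; rewrite !mxE pull_slack.
  exact: minor_P.
rewrite rmorphM rmorphXn rmorph_prod; apply: slack_ideal_exp => g.
apply: slack_ideal_prod => i {}g; rewrite /= /pull mmapX mmap1U.
exact: slack_ideal_zvar.
Qed.

Local Notation lattice := {ffun facet W * vertex W -> int}.

Definition dz (H : facet W) (z : vertex W) : lattice := [ffun p => (p == (H, z))%:R].

Lemma dzE H z H' z' : dz H z (H', z') = (delta H z H' z')%:Z.
Proof. by rewrite ffunE xpair_eqE /delta [H' == H]eq_sym [z' == z]eq_sym natz. Qed.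

Hypothesis TP : forall f, graph_ideal k P f -> slack_ideal k P f.

(** The positive and negative parts of [u] are balanced, so their binomial is in the graph ideal of
    [P], hence in its slack ideal, and [pull] carries it to [I]. *)
Lemma pull_lat (u : facet P -> vertex P -> int) :
    (forall F x, incident F x -> u F x = 0) ->
    (forall F, \sum_x u F x = 0) -> (forall x, \sum_F u F x = 0) ->
  lat k (\sum_F \sum_x dz (liftP F) (iP x) *~ u F x).
Proof.
move=> su ru cu.
pose m F x := if (0 <= u F x)%R then `|u F x|%N else 0%N.
pose m' F x := if (0 <= u F x)%R then 0%N else `|u F x|%N.
have um F x : u F x = (m F x)%:Z - (m' F x)%:Z.
  rewrite /m /m'; case: ifPn => h; first by rewrite subr0 gez0_abs.
  by rewrite sub0r ltz0_abs ?opprK // ltNge.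
have sm : supported m by move=> F x i; rewrite /m su.
have sm' : supported m' by move=> F x i; rewrite /m' su.
have sumE (J : finType) (f g : J -> nat) :
    \sum_j ((f j)%:Z - (g j)%:Z) = 0 -> (\sum_j f j = \sum_j g j)%N.
  rewrite sumrB -!Posz_sum => /eqP; rewrite subr_eq0 eqz_nat => /eqP h.
  exact: h.
have bal : balanced m m'.
  split=> i; apply: sumE; [apply: etrans (ru i)|apply: etrans (cu i)];
  by apply: eq_bigr => j _; rewrite um.
have := pull_ideal (TP (balanced_binomial_in k sm sm' bal)).
pose push (n : facet P -> vertex P -> nat) H z :=
  (\sum_F \sum_x n F x * delta (liftP F) (iP x) H z)%N.
have pullX n : supported n -> pull (monX k n) = monX k (push n).
  move=> sn; rewrite /push monX_sum rmorph_prod; apply: eq_bigr => F _.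
  rewrite monX_sum rmorph_prod; apply: eq_bigr => x _ /=.
  rewrite rmorphXn /=; have [i|ni] := boolP (incident F x).
    rewrite sn // expr0 -monX0; apply: eq_monX => H z.
    by rewrite mul0n.
  rewrite pull_zvar // -monX_delta; elim: (n F x) => [|j IHj].
    by rewrite expr0 -monX0; apply: eq_monX => H z; rewrite mul0n.
  by rewrite exprS IHj -monXD; apply: eq_monX => H z; rewrite mulSn.
rewrite rmorphB /= !pullX // => Im; exists (push m), (push m'); split=> // H z.
rewrite /push sum_ffunE !Posz_sum -sumrB; apply: eq_bigr => F _.
rewrite sum_ffunE !Posz_sum -sumrB; apply: eq_bigr => x _.
by rewrite ffunMzE dzE !PoszM -mulrBl -um -mulrzl intz.
Qed.

Variable u : lattice.
Hypothesis su : forall H z, incident H z -> u (H, z) = 0.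
Hypothesis ru : forall H, \sum_z u (H, z) = 0.
Hypothesis cu : forall z, \sum_H u (H, z) = 0.

Let p := iP v.

(* Two facets of W with the same trace F on P differ only by 2x2 minors, so the
   edges at H can be moved to the chosen facet lying over F. *)
Lemma part_lat :
  lat k (\sum_H \sum_(x | x != v) (dz H (iP x) - dz H p) *~ u (H, iP x)).
Proof.
(* The trace is not a facet only when [H] contains all of [P]; then [u] vanishes at [H] on the
   vertices of [P], and the default [H] in [rP] is harmless. *)
pose trP (H : facet W) : option (facet P) := insub (iP @^-1: val H).
pose rP H := if trP H is Some F then liftP F else H.
have trP_val H F : trP H = Some F -> iP @^-1: val H = val F.
  by rewrite /trP; case: insubP => // F' _ <- [->].
have trP_inc H F x : trP H = Some F -> incident H (iP x) = incident F x.
  by move=> /trP_val e; rewrite /incident -e [RHS]inE.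
have trP_ex H x : ~~ incident H (iP x) -> exists F, trP H = Some F.
  move=> n; case: (facet_trace gl (facetP H)) => [e|[fT _]|[fT _ _]].
  - by move: n; have := in_setT x; rewrite -e inE /incident => ->.
  - by exists (mkfacet fT); rewrite /trP -[X in insub X]/(val (mkfacet fT)) valK.
  - by exists (mkfacet fT); rewrite /trP -[X in insub X]/(val (mkfacet fT)) valK.
have u0 H x : trP H = None -> u (H, iP x) = 0.
  move=> n; apply: su; apply/negPn/negP => /trP_ex[F].
  by rewrite n.
have fiber (V : zmodType) (h : facet W -> V) : (forall H, trP H = None -> h H = 0) ->
    \sum_F \sum_(H | trP H == Some F) h H = \sum_H h H.
  move=> h0; rewrite (exchange_big_dep xpredT) //=; apply: eq_bigr => H _.
  case e: (trP H) => [F|]; last by rewrite big1 ?h0 // => F /eqP.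
  by rewrite (big_pred1 F).
pose E H x := dz H (iP x) - dz H p.
(* If [v] is in [F], a facet over [F] contains all of [Q], so [rP H] is [H]; otherwise the columns
   [iP x] and [p] give a 2x2 minor. *)
have lat_cell H x : ~~ incident H (iP x) -> lat k (E H x - E (rP H) x).
  move=> nHx; have [F tF] := trP_ex H x nHx.
  have rH : rP H = liftP F by rewrite /rP tF.
  have nFx : ~~ incident F x by rewrite -(trP_inc H).
  have [vF|vF] := boolP (incident F v).
    suff -> : rP H = H by rewrite subrr; apply: lat0.
    rewrite rH; apply/val_inj/(trace_inj gl); first by rewrite liftPE (trP_val _ _ tF).
    rewrite liftPT //; case: (facet_trace gl (facetP H)) => [e|[_ ->]//|[_ _]].
      by move: nHx; have := in_setT x; rewrite -e inE /incident => ->.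
    by rewrite (trP_val _ _ tF) -[v \in _]/(incident F v) vF.
  have rF : iP @^-1: val (rP H) = val F by rewrite rH liftPE.
  apply: (lat_square (dzE H (iP x)) (dzE H p) (dzE (rP H) (iP x)) (dzE (rP H) p)).
  rewrite (monX_delta k H (iP x)) (monX_delta k (rP H) p).
  rewrite (monX_delta k H p) (monX_delta k (rP H) (iP x)).
  exact: two_minor (trP_val _ _ tF) rF nFx vF.
(* Summed over the facets above [F], the coefficients form a matrix on [P]. Its column at [v] is
   replaced so that rows sum to zero, to account for the terms at [p] in [E]. *)
pose g F x := \sum_(H | trP H == Some F) u (H, iP x).
pose cP F x := if x == v then - \sum_(x' | x' != v) g F x' else g F x.
have cP_col x : \sum_F g F x = 0.
  by rewrite fiber // => H; apply: u0.
(* When [v] is in [F], a facet over [F] contains all of [Q], so only vertices of [P] other than [v]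
   contribute to its row sum in [u]. *)
have cP_supp F x : incident F x -> cP F x = 0.
  move=> iFx; rewrite /cP; case: eqP => [xv|_]; last first.
    by apply: big1 => H /eqP tF; apply: su; rewrite (trP_inc H F).
  rewrite /g exchange_big big1 ?oppr0 // => H /eqP tF.
  have vH : incident H (iP v) by rewrite (trP_inc H F) // -xv.
  have := ru H; rewrite sum_glued su // add0r [X in _ + X]big1 ?addr0 // => y _.
  apply: su; case: (facet_trace gl (facetP H)) => [e|[_ e]|[_ _]].
  - have [z zF] := facet_proper (facetP F).
    by move: zF; rewrite -(trP_val _ _ tF) e inE.
  - by have := in_setT y; rewrite -e inE.
  - by rewrite inE -/(incident H (iP v)) vH.
have cP_row F : \sum_x cP F x = 0.
  rewrite (bigD1 v) //= {1}/cP eqxx addrC; apply/eqP; rewrite subr_eq0; apply/eqP.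
  by apply: eq_bigr => x /negPf n; rewrite /cP n.
have cP_col' x : \sum_F cP F x = 0.
  rewrite /cP; case: eqP => _; last exact: cP_col.
  by rewrite sumrN exchange_big big1 ?oppr0.
have lP := pull_lat cP_supp cP_row cP_col'.
(* Each [E H x] is moved to the chosen facet; the moved terms, grouped by trace, form the vector of
   [cP]. *)
have -> : \sum_H \sum_(x | x != v) (dz H (iP x) - dz H p) *~ u (H, iP x) =
    \sum_H \sum_(x | x != v) (E H x - E (rP H) x) *~ u (H, iP x) +
    \sum_F \sum_x dz (liftP F) (iP x) *~ cP F x.
  have -> : \sum_F \sum_x dz (liftP F) (iP x) *~ cP F x =
      \sum_F \sum_(x | x != v) E (liftP F) x *~ g F x.
    apply: eq_bigr => F _; rewrite (bigD1 v) //= {1}/cP eqxx mulrNz mulrz_sumr -sumrN.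
    rewrite -big_split; apply: eq_bigr => x /negPf n /=.
    by rewrite /cP n /E mulrzBl addrC.
  have -> : \sum_F \sum_(x | x != v) E (liftP F) x *~ g F x =
      \sum_F \sum_(H | trP H == Some F) \sum_(x | x != v) E (rP H) x *~ u (H, iP x).
    apply: eq_bigr => F _; rewrite [RHS]exchange_big; apply: eq_bigr => x _.
    by apply: mulrz_sum_const => H /eqP tF; rewrite /rP tF.
  rewrite fiber => [|H n]; last by apply: big1 => x _; rewrite u0.
  rewrite -big_split; apply: eq_bigr => H _; rewrite -big_split; apply: eq_bigr => x _.
  by rewrite /= -mulrzDl subrK.
apply: latD => //; apply: lat_sum => H _; apply: lat_sum => x _.
have [i|n] := boolP (incident H (iP x)); last by apply/lat_mulz/lat_cell.
by rewrite su // mulr0z; apply: lat0.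
Qed.

End GluedLattice.

Lemma glued_lifts (R : realFieldType) (a b c : nat) (P : polytope R a)
    (v : vertex P) (Q : polytope R b) (w : vertex Q) (W : polytope R c)
    (iP : vertex P -> vertex W) (iQ : vertex Q -> vertex W) :
    glued v w iP iQ ->
  exists liftP : facet P -> facet W, forall F : facet P,
    iP @^-1: val (liftP F) = val F /\
    (v \in val F -> iQ @^-1: val (liftP F) = [set: vertex Q]).
Proof.
move=> gl; have ex (F : facet P) : exists H : facet W, iP @^-1: val H = val F /\
    (v \in val F -> iQ @^-1: val H = [set: vertex Q]).
  have [H [fH eP eQ]] := lift_facet gl (facetP F).
  by exists (mkfacet fH).
by have [f fE] := choice ex; exists f.
Qed.

(** As the rows of [u] sum to 0, each unit vector may be replaced by its difference with the one in
    the same row at the common vertex. The terms at that vertex then vanish, and [u] splits into a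
    part over [P] and a part over [Q]. *)
Lemma glued_lat (k : fieldType) (R : realFieldType) (a b c : nat)
    (P : polytope R a) (v : vertex P) (Q : polytope R b) (w : vertex Q)
    (W : polytope R c) (iP : vertex P -> vertex W) (iQ : vertex Q -> vertex W)
    (u : {ffun facet W * vertex W -> int}) :
    glued v w iP iQ ->
    (forall f, graph_ideal k P f -> slack_ideal k P f) ->
    (forall f, graph_ideal k Q f -> slack_ideal k Q f) ->
    (forall H z, incident H z -> u (H, z) = 0) ->
    (forall H, \sum_z u (H, z) = 0) -> (forall z, \sum_H u (H, z) = 0) ->
  lat k u.
Proof.
move=> gl TP TQ su ru cu; have gl' := glued_sym gl.
have [liftP lP] := glued_lifts gl; have [liftQ lQ] := glued_lifts gl'.
have LP := part_lat gl (fun F => proj1 (lP F)) (fun F => proj2 (lP F))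
  (fun F => proj1 (lQ F)) (fun F => proj2 (lQ F)) TP su ru cu.
have LQ := part_lat gl' (fun F => proj1 (lQ F)) (fun F => proj2 (lQ F))
  (fun F => proj1 (lP F)) (fun F => proj2 (lP F)) TQ su ru cu.
have -> : u = \sum_H \sum_z dz H z *~ u (H, z).
  apply/ffunP => -[H z].
  transitivity (\sum_H' \sum_z' (delta H' z' H z)%:Z * u (H', z')).
    rewrite (bigD1 H) //= (bigD1 z) //= {1}/delta !eqxx mul1r big1 => [|z' /negPf n].
      rewrite big1 ?addr0 // => H' /negPf n; rewrite big1 // => z' _.
      by rewrite /delta n mul0r.
    by rewrite /delta n andbF mul0r.
  rewrite sum_ffunE; apply: eq_bigr => H' _; rewrite sum_ffunE; apply: eq_bigr => z' _.
  by rewrite (ffunMzE (dz H' z')) (dzE H' z') -mulrzl intz mulrC.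
have -> : \sum_H \sum_z dz H z *~ u (H, z) =
    \sum_H \sum_(x | x != v) (dz H (iP x) - dz H (iP v)) *~ u (H, iP x) +
    \sum_H \sum_(y | y != w) (dz H (iQ y) - dz H (iQ w)) *~ u (H, iQ y).
  rewrite -big_split; apply: eq_bigr => H _.
  have := congr1 (fun n => dz H (iP v) *~ n) (ru H).
  rewrite /= mulr0z (sum_glued gl) (sum_glued gl).
  rewrite !mulrzDr !mulrz_sumr => h.
  have split_sub (V : zmodType) (e x y x' y' : V) :
      e + x' + y' = 0 -> e + x + y = x - x' + (y - y').
    move=> /eqP; rewrite -addrA addr_eq0 => /eqP ->.
    by rewrite -addrA opprD addrACA [- x' + x]addrC [- y' + y]addrC.
  rewrite -(glued_pt gl).
  under [X in _ = X + _]eq_bigr do rewrite mulrzBl.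
  under [X in _ = _ + X]eq_bigr do rewrite mulrzBl.
  by rewrite !sumrB; apply: split_sub.
exact: latD.
Qed.

(** * Rank of the non-incidence matrix of a vertex sum *)

Section GluedRank.
Variables (k : fieldType) (R : realFieldType) (a b c : nat).
Variables (P : polytope R a) (v : vertex P) (Q : polytope R b) (w : vertex Q).
Variables (W : polytope R c).
Variables (iP : vertex P -> vertex W) (iQ : vertex Q -> vertex W).
Hypothesis gl : glued v w iP iQ.
Hypothesis detP : forall (r : 'I_(pdim P).+2 -> facet P) x,
  \det (nonincidence k r x) = 0.

Definition trace_mx : 'M[k]_(#|{: facet W}|, nvert P) :=
  \matrix_(i, x) (~~ incident (enum_val i) (iP x))%:R.

(** By [facet_trace] each row is zero or a row of the non-incidence matrix of [P], so all minors of
    size [(pdim P).+2] vanish. *)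
Lemma rank_trace_mx : (\rank trace_mx <= (pdim P).+1)%N.
Proof.
rewrite -ltnS; apply: rank_lt_minors => f g.
have [/existsP[i /eqP e]|] := boolP [exists i,
    iP @^-1: val (enum_val (f i)) == [set: vertex P]].
  rewrite (expand_det_row _ i) big1 // => j _; rewrite !mxE.
  by have := in_setT (g j); rewrite -e inE /incident => ->; rewrite mul0r.
rewrite negb_exists => /forallP nT.
have ex i : exists F : facet P, val F = iP @^-1: val (enum_val (f i)).
  have := nT i; case: (facet_trace gl (facetP (enum_val (f i)))) => [->|[fT _] _|[fT _ _] _].
  - by rewrite eqxx.
  - by exists (mkfacet fT).
  - by exists (mkfacet fT).
have [r rE] := choice ex; rewrite -(detP r g); congr (\det _).
by apply/matrixP => i j; rewrite !mxE /incident rE inE.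
Qed.

End GluedRank.

Lemma glued_nonincidence (k : fieldType) (R : realFieldType) (a b c : nat)
    (P : polytope R a) (v : vertex P) (Q : polytope R b) (w : vertex Q)
    (W : polytope R c) (iP : vertex P -> vertex W) (iQ : vertex Q -> vertex W) :
    glued v w iP iQ ->
    (forall (r : 'I_(pdim P).+2 -> facet P) x, \det (nonincidence k r x) = 0) ->
    (forall (r : 'I_(pdim Q).+2 -> facet Q) x, \det (nonincidence k r x) = 0) ->
  forall (r : 'I_(pdim W).+2 -> facet W) z, \det (nonincidence k r z) = 0.
Proof.
move=> gl detP detQ r z; have gl' := glued_sym gl.
pose M : 'M[k]_(#|{: facet W}|, nvert W) :=
  \matrix_(i, u) (~~ incident (enum_val i) u)%:R.
have -> : nonincidence k r z = mxsub (fun i => enum_rank (r i)) z M.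
  by apply/matrixP => i j; rewrite !mxE enum_rankK.
apply: minor0_rank_lt; rewrite ltnS -mxrank_tr.
set A := (trace_mx k iP)^T; set B := (trace_mx k iQ)^T.
have rA : (\rank A <= (pdim P).+1)%N by rewrite mxrank_tr; apply: rank_trace_mx gl detP.
have rB : (\rank B <= (pdim Q).+1)%N by rewrite mxrank_tr; apply: rank_trace_mx gl' detQ.
have colE u : row u M^T = \row_i (~~ incident (enum_val i) u)%:R.
  by apply/rowP => i; rewrite !mxE.
have rowA x : row x A = \row_i (~~ incident (enum_val i) (iP x))%:R.
  by apply/rowP => i; rewrite !mxE.
have rowB y : row y B = \row_i (~~ incident (enum_val i) (iQ y))%:R.
  by apply/rowP => i; rewrite !mxE.
have sub : (M^T <= A + B)%MS.
  have [_ _ _ cov _] := gl; apply/row_subP => u; rewrite colE.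
  have [[x ->]|[y ->]] := cov u; rewrite -?rowA -?rowB.
    exact: submx_trans (row_sub _ _) (addsmxSl _ _).
  exact: submx_trans (row_sub _ _) (addsmxSr _ _).
(* The two row spaces share the row of the common vertex, nonzero because some facet of [W] avoids
   that vertex. *)
have cap : (0 < \rank (A :&: B)%MS)%N.
  have [|F [fF _ vF]] := @facet_sep _ _ P set0 v (is_face0 P); first by rewrite inE.
  have [H [fH eH _]] := lift_facet gl fF.
  have : (row v A <= A :&: B)%MS.
    by rewrite sub_capmx row_sub rowA (glued_pt gl) -rowB row_sub.
  move/mxrankS; apply: leq_trans; rewrite rank_rV lt0b rowA.
  apply/eqP => /rowP/(_ (enum_rank (mkfacet fH)))/eqP; rewrite !mxE enum_rankK.
  by rewrite /incident /=; move: vF; rewrite -eH inE => ->; rewrite oner_eq0.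
apply: leq_trans (mxrankS sub) _; rewrite (pdim_glued gl).
rewrite -ltnS -addSn -addnS; apply: leq_trans (leq_add rA rB).
by rewrite -mxrank_sum_cap -[X in (X < _)%N]addn0 ltn_add2l.
Qed.

Local Open Scope classical_set_scope.

Theorem theorem3p9 (R : realFieldType) (k : fieldType) (a b c : nat)
    (P : polytope R a) (Q : polytope R b) (v : vertex P) (w : vertex Q)
    (W : polytope R c) (sumW : is_vertex_sum v w W) :
  (graph_ideal k P `<=` slack_ideal k P ->
   graph_ideal k Q `<=` slack_ideal k Q ->
   graph_ideal k W `<=` slack_ideal k W) /\
  (graphic k P -> graphic k Q -> graphic k W).
Proof.
have [iP [iQ gl]] := vertex_sum_glued sumW.
have graph_sub : (forall f, graph_ideal k P f -> slack_ideal k P f) ->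
    (forall f, graph_ideal k Q f -> slack_ideal k Q f) ->
    forall f, graph_ideal k W f -> slack_ideal k W f.
  move=> TP TQ; apply: ideal_gen_min; first exact: slack_ideal_ideal.
  move=> _ [C [_ uC _] ->]; rewrite cycle_binomialE //.
  have [sf sb [rowE colE]] := cycle_balanced uC.
  (* The exponent difference of the two monomials of the cycle is supported on edges and sums to
     zero at each node, so [glued_lat] applies. *)
  pose u : {ffun facet W * vertex W -> int} :=
    [ffun e => (fwd C e.1 e.2)%:Z - (bwd C e.1 e.2)%:Z].
  have uE H z : u (H, z) = (fwd C H z)%:Z - (bwd C H z)%:Z by rewrite ffunE.
  apply: (lat_binomial (u := u)) => //; apply: (glued_lat gl TP TQ).
  - by move=> H z i; rewrite uE sf // sb // subrr.
  - move=> H; under eq_bigr do rewrite uE.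
    by rewrite sumrB -!Posz_sum rowE subrr.
  - move=> z; under eq_bigr do rewrite uE.
    by rewrite sumrB -!Posz_sum colE subrr.
split=> [TP TQ|gP gQ]; first exact: graph_sub.
have eqP (X : nat) (p : polytope R X) : graphic k p ->
    forall f, slack_ideal k p f <-> graph_ideal k p f.
  by move=> e f; rewrite e.
(* The rank bounds on the summands give the inclusion of the slack ideal in the graph ideal; the
   other inclusion is the first part of the theorem. *)
have detP := graphic_nonincidence (fun f => proj1 (eqP _ _ gP f)).
have detQ := graphic_nonincidence (fun f => proj1 (eqP _ _ gQ f)).
apply/seteqP; split=> f.
  exact: slack_sub_graph (glued_nonincidence gl detP detQ) f.
by apply: graph_sub => g; [apply: (proj2 (eqP _ _ gP g)) | apply: (proj2 (eqP _ _ gQ g))].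
Qed.
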